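(* Let $k$ be an algebraically closed field of characteristic zero, let $g\geq 2$ be an integer, and let $\lambda_1,\dotsc,\lambda_{2g+1}\in k$ be pairwise distinct. Consider $\mathbb{P}^{2g}$ with homogeneous coordinates $(x_1:\cdots:x_{2g+1})$, and let $Q_1,Q_2\subset\mathbb{P}^{2g}$ be the quadrics $$Q_1\colon \sum_{j=1}^{2g+1}x_j^2=0,\qquad Q_2\colon \sum_{j=1}^{2g+1}\lambda_jx_j^2=0.$$ Then the variety $\mathcal{G}$ of $(g-2)$-dimensional linear subspaces of $\mathbb{P}^{2g}$ contained in $Q_1\cap Q_2$ is a rational variety.
   Context: All varieties are over the algebraically closed field $k$ of characteristic zero. $\mathcal{G}$ is the closed subvariety of the Grassmannian $\mathrm{Gr}(g-2,\mathbb{P}^{2g})$ of $(g-2)$-dimensional projective linear subspaces of $\mathbb{P}^{2g}$ parametrizing those contained in $Q_1\cap Q_2$; it is known to be smooth and connected of dimension $2g-2$. A variety over $k$ is rational if it is birational to a projective space over $k$. *)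

(* Defs.v *)
From mathcomp Require Import all_boot all_order all_algebra.
From mathcomp.multinomials Require Import mpoly.

Set Implicit Arguments.
Unset Strict Implicit.
Unset Printing Implicit Defensive.

Import GRing.Theory.
Local Open Scope ring_scope.

(* Classical projective geometry over a field k. A point of P^(N-1) is given by
   a nonzero row vector x : 'rV[k]_N of homogeneous coordinates; two nonzero
   vectors x, y are the same point iff (x == y)%MS (they span the same line).
   A set of points is a predicate on 'rV[k]_N; all the sets used below contain
   only nonzero vectors and are stable under rescaling. *)

Section ProjectiveGeometry.

Variable k : closedFieldType.

Definition pset (N : nat) := 'rV[k]_N -> Prop.

Definition proj_space (n : nat) : pset n.+1 := fun x => x != 0.

Definition zariski_closed N (Z : pset N) : Prop :=
  exists F : {mpoly k[N]} -> Prop,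
    (forall p, F p -> exists d, p \is d.-homog) /\
    (forall x, Z x <-> x != 0 /\ forall p, F p -> p.@[x 0] = 0).

Definition open_in N (X U : pset N) : Prop :=
  exists Z : pset N, zariski_closed Z /\ forall x, U x <-> X x /\ ~ Z x.

Definition dense_in N (X U : pset N) : Prop :=
  forall Z : pset N, zariski_closed Z ->
    (forall x, U x -> Z x) -> forall x, X x -> Z x.

(* A morphism U -> V: around every point of U, the map f is given in
   homogeneous coordinates by forms P_j of the same degree without common zero.
   This forces f to be compatible with rescaling on U. *)
Definition regular_map N M (U : pset N) (V : pset M)
    (f : 'rV[k]_N -> 'rV[k]_M) : Prop :=
  (forall x, U x -> V (f x)) /\
  forall x, U x ->
    exists (O : pset N) (d : nat) (P : 'I_M -> {mpoly k[N]}),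
      [/\ open_in U O, O x, forall j, P j \is d.-homog &
          forall y, O y ->
            \row_j (P j).@[y 0] != 0 /\ (f y == \row_j (P j).@[y 0])%MS].

Definition isomorphic N M (U : pset N) (V : pset M) : Prop :=
  exists (f : 'rV[k]_N -> 'rV[k]_M) (h : 'rV[k]_M -> 'rV[k]_N),
    [/\ regular_map U V f, regular_map V U h,
        forall x, U x -> (h (f x) == x)%MS &
        forall y, V y -> (f (h y) == y)%MS].

Definition birational N M (X : pset N) (Y : pset M) : Prop :=
  exists (U : pset N) (V : pset M),
    [/\ open_in X U, dense_in X U, open_in Y V, dense_in Y V &
        isomorphic U V].

(* The open sets in [birational] are required to be dense, so a rational set is
   irreducible, being the closure in itself of a nonempty open subset of P^n. *)
Definition rational N (X : pset N) : Prop :=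
  exists n : nat, birational X (@proj_space n).

Definition diag_quadric n (a : 'I_n.+1 -> k) : pset n.+1 :=
  fun x => x != 0 /\ \sum_j a j * x 0 j ^+ 2 = 0.

(* Strictly increasing maps 'I_r -> 'I_n, i.e. the r-subsets of 'I_n. *)
Definition incr_maps (r n : nat) : {set {ffun 'I_r -> 'I_n}} :=
  [set s : {ffun 'I_r -> 'I_n} |
    [forall i : 'I_r, forall j : 'I_r, (i < j)%N ==> (s i < s j)%N]].

(* The maximal minors of A; for A of full row rank these are the Pluecker
   coordinates of its row space. *)
Definition pluecker (r n : nat) (A : 'M[k]_(r, n)) : 'rV[k]_#|incr_maps r n| :=
  \row_(s < #|incr_maps r n|)
    \det (colsub (enum_val s : {ffun 'I_r -> 'I_n}) A).

(* The d-dimensional projective linear subspaces of P^n contained in X, as a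
   subset of Gr(d, P^n) in its Pluecker embedding. Such a subspace is the row
   space of a (d+1) x (n+1) matrix A of rank d+1. *)
Definition linear_subspaces_in (d n : nat) (X : pset n.+1) :
    pset #|incr_maps d.+1 n.+1| :=
  fun w => exists A : 'M[k]_(d.+1, n.+1),
    [/\ row_free A,
        forall v : 'rV[k]_n.+1, v != 0 -> (v <= A)%MS -> X v &
        (w == pluecker A)%MS].

End ProjectiveGeometry.

Arguments linear_subspaces_in {k} d {n} X w.

(* Main.v *)
Require Import Defs.
From HB Require Import structures.
From mathcomp Require Import all_boot all_order all_fingroup all_algebra.
From mathcomp Require Import zify ring.
From mathcomp.multinomials Require Import mpoly.

(* Write r = g - 1. Identify the ambient space with k[x]/(f), where f has the roots
   lambda_i, so that the two forms become the residues of h^2/f and x h^2/f; the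
   polynomials of degree < g span a subspace L of dimension g isotropic for both.

   A subspace W in G with W meeting L trivially is a graph over (W + L)/L, a point of
   Gr(g-1, g+1), and isotropy is a system of r(r+1) linear equations in the r(r+1)
   entries of the graph. The system is governed by the pencil of polynomials (s, t) of
   degree <= g annihilating W, and is invertible when s and t are coprime. This
   gives mutually inverse rational maps between G and an affine chart of Gr(g-1, g+1),
   hence an isomorphism of open subsets.

   For density in G: if W meets neither L nor any of its images L_i under one sign
   change, then s and t are coprime, because a common root produces an isotropic
   subspace of too large dimension for a member of the pencil, or a common vector of
   W and some L_i. If W meets L or some L_i, choose a coordinate i which is nonzero on
   the intersection; W moves in a conic of subspaces, a ruling of the first quadric
   restricted to a subspace of dimension g + 1 which is isotropic for the quadric of
   the pencil singular at the i-th coordinate point. The ruling can be chosen so that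
   the intersection drops off W, and by semicontinuity the other intersections do not
   grow. By induction on the sum of their dimensions, W is in the closure. *)

Set Implicit Arguments.
Unset Strict Implicit.
Unset Printing Implicit Defensive.

Import GRing.Theory.
Local Open Scope ring_scope.

(** * Pluecker coordinates and closures *)

Section Minors.

Variable R : comNzRingType.

Definition minors r n (A : 'M[R]_(r, n)) : 'rV[R]_#|incr_maps r n| :=
  \row_s \det (colsub (enum_val s : {ffun 'I_r -> 'I_n}) A).

Lemma sort_injection r n (f : {ffun 'I_r -> 'I_n}) : injective f ->
  exists (s : {ffun 'I_r -> 'I_n}) (p : 'S_r),
    s \in incr_maps r n /\ forall i, f i = s (p i).
Proof.
move=> injf; pose le := fun x y : 'I_n => (x <= y)%N.
pose t := [tuple f i | i < r]; pose t' := [tuple of sort le t].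
have /tuple_permP[p Ep] : perm_eq t t' by rewrite perm_sym perm_sort.
pose s := [ffun i => tnth t' i].
have Es i : f i = s (p i).
  have /(congr1 (fun z => nth (f i) z i)) := Ep.
  rewrite -!tnth_nth !tnth_mktuple ffunE => ->.
  by rewrite (tnth_nth (f i)).
exists s, p; split => //; rewrite inE; apply/forallP => i; apply/forallP => j.
apply/implyP => ij; rewrite ltn_neqAle; apply/andP; split.
  apply/eqP => /val_inj; rewrite -(permKV p i) -(permKV p j) -!Es => /injf.
  by move/(congr1 p); rewrite !permKV => /(congr1 val) /= E; rewrite E ltnn in ij.
rewrite !ffunE (tnth_nth (f i)) (tnth_nth (f i) t' j).
have le_tr : transitive le by move=> x y z; apply: leq_trans.
have so : sorted le t' by apply: sort_sorted => x y; apply: leq_total.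
apply: (sorted_ltn_nth le_tr (f i) so) => //.
  by rewrite inE size_tuple.
by rewrite inE size_tuple.
Qed.

(** The coefficients are uniform in [A]: a repeated column gives zero, and otherwise sorting the
    selected columns costs only a sign. *)
Lemma det_colsub_minors r n (f : {ffun 'I_r -> 'I_n}) :
  exists c : 'I_#|incr_maps r n| -> R,
    forall A : 'M[R]_(r, n), \det (colsub f A) = \sum_s c s * minors A 0 s.
Proof.
case: (boolP (injectiveb f)) => [/injectiveP injf | /injectivePn[i [j ij fij]]];
  last first.
  exists (fun=> 0) => A; rewrite big1 => [|s _]; last by rewrite mul0r.
  rewrite -det_tr; apply: (determinant_alternate ij) => a.
  by rewrite !mxE fij.
have [s [p [sI Ef]]] := sort_injection injf.
exists (fun s' => if enum_val s' == s then (-1) ^+ p else 0) => A.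
rewrite (bigD1 (enum_rank_in sI s)) //= enum_rankK_in // eqxx.
rewrite big1 ?addr0 => [|s' ns]; last first.
  case: eqP => [E|]; last by rewrite mul0r.
  by case/eqP: ns; apply: enum_val_inj; rewrite enum_rankK_in.
rewrite mxE enum_rankK_in //.
have -> : colsub f A = col_perm p (colsub s A).
  by apply/matrixP => a b; rewrite !mxE Ef.
by rewrite col_permE det_mulmx det_perm odd_permV mulrC.
Qed.

Lemma det_mulmx_colsub r n (A : 'M[R]_(r, n)) (K : 'M[R]_(n, r)) :
  \det (A *m K) =
  \sum_(f : {ffun 'I_r -> 'I_n}) (\prod_j K (f j) j) * \det (colsub f A).
Proof.
rewrite -det_tr.
transitivity (\sum_(s : 'S_r) \sum_(f : {ffun 'I_r -> 'I_n})
   (-1) ^+ s * \prod_j (A (s j) (f j) * K (f j) j)).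
  apply: eq_bigr => s _; rewrite -big_distrr /=; congr (_ * _).
  rewrite -(bigA_distr_bigA (fun j l => A (s j) l * K l j)) /=.
  by apply: eq_bigr => j _; rewrite !mxE.
rewrite exchange_big; apply: eq_bigr => f _ /=.
rewrite -det_tr big_distrr; apply: eq_bigr => s _ /=.
rewrite big_split /= [in RHS]mulrCA; congr (_ * _); rewrite mulrC; congr (_ * _).
by apply: eq_bigr => j _; rewrite !mxE.
Qed.

(** A form of Cauchy-Binet. As the coefficients are uniform in [A], such determinants are linear
    forms in the Pluecker coordinates. *)
Lemma det_mulmx_minors r n (K : 'M[R]_(n, r)) :
  exists c : 'I_#|incr_maps r n| -> R,
    forall A : 'M[R]_(r, n), \det (A *m K) = \sum_s c s * minors A 0 s.
Proof.
have [c Ec] := fin_all_exists (fun f => @det_colsub_minors r n f).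
exists (fun s => \sum_(f : {ffun 'I_r -> 'I_n}) (\prod_j K (f j) j) * c f s) => A.
rewrite det_mulmx_colsub.
under eq_bigr => f _ do rewrite Ec big_distrr.
rewrite exchange_big; apply: eq_bigr => s _ /=; rewrite mulr_suml.
by apply: eq_bigr => f _; rewrite mulrA.
Qed.

Lemma minors_mulmx r n (P : 'M[R]_r) (A : 'M[R]_(r, n)) :
  minors (P *m A) = \det P *: minors A.
Proof.
apply/rowP => s; rewrite !mxE -det_mulmx; congr (\det _).
by apply/matrixP => i j; rewrite !mxE; apply: eq_bigr => a _; rewrite !mxE.
Qed.



End Minors.

Lemma map_minors (R S : comNzRingType) (f : {rmorphism R -> S}) r n
  (A : 'M[R]_(r, n)) : map_mx f (minors A) = minors (map_mx f A).
Proof.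
apply/rowP => s; rewrite !mxE -det_map_mx; congr (\det _).
by apply/matrixP => i j; rewrite !mxE.
Qed.

Section Pluecker.

Variable k : closedFieldType.

Lemma pluecker_neq0 r n (A : 'M[k]_(r, n)) : row_free A -> pluecker A != 0.
Proof.
case/row_freeP => K AK; have [c Ec] := det_mulmx_minors K.
apply/eqP => A0; have := Ec A; rewrite AK det1 [minors A]A0.
by rewrite big1 => [/eqP|s _]; rewrite ?oner_eq0 // mxE mulr0.
Qed.

(** Rescaling one row rescales the Pluecker vector, so every representative of the point is itself a
    vector of minors. *)
Lemma eq_pluecker_row_space r n (A : 'M[k]_(r.+1, n)) (w : 'rV_#|incr_maps r.+1 n|) :
  row_free A -> (w == pluecker A)%MS ->
  exists A' : 'M[k]_(r.+1, n), (A' :=: A)%MS /\ w = pluecker A'.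
Proof.
move=> fA /andP[/sub_rVP[a Ea] /sub_rVP[b Eb]].
have a0 : a != 0.
  apply: contraTneq (pluecker_neq0 fA) => a0.
  by rewrite Eb Ea a0 scale0r scaler0 eqxx.
pose P : 'M[k]_r.+1 := diag_mx (\row_j if j == 0 then a else 1).
have dP : \det P = a.
  rewrite det_diag (bigD1 0) //= mxE eqxx big1 ?mulr1 // => i i0.
  by rewrite mxE (negPf i0).
exists (P *m A); split; last by rewrite [pluecker _]minors_mulmx dP.
apply: eqmxMfull; rewrite row_full_unit unitmxE dP unitfE //.
Qed.

(** [p + 1] takes only the value 1, so it has no root and is constant. *)
Lemma poly_vanish (p : {poly k}) : (forall x, p.[x] = 0) -> p = 0.
Proof.
move=> p0; case: (boolP (size (p + 1) == 1)) => [/size_poly1P[c _ Ec]|].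
  have Ep : p = (c - 1)%:P by rewrite polyCB -Ec addrK.
  by have := p0 0; rewrite Ep hornerC => ->; rewrite polyC0.
by case/closed_rootP => x; rewrite rootE hornerD p0 hornerC add0r oner_eq0.
Qed.

Lemma mpoly_along_curve n (p : {mpoly k[n]}) (v : 'I_n -> {poly k}) :
  exists q : {poly k}, forall t, q.[t] = p.@[fun i => (v i).[t]].
Proof.
exists (\sum_(m <- msupp p) p@_m *: \prod_i v i ^+ m i) => t.
rewrite mevalE horner_sum; apply: eq_bigr => m _; rewrite hornerZ horner_prod.
by congr (_ * _); apply: eq_bigr => i _; rewrite horner_exp.
Qed.

(** The tool of all density arguments: an equation of [Z] pulled back to the curve and multiplied by
    [d] vanishes at every parameter, so the pulled back equation is zero and holds at [t0] too. *)
Lemma closed_curve N (Z : pset k N) (v : 'rV[{poly k}]_N) (d : {poly k}) t0 :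
  zariski_closed Z -> d != 0 ->
  (forall t, d.[t] != 0 -> Z (map_mx (horner_eval t) v)) ->
  map_mx (horner_eval t0) v != 0 -> Z (map_mx (horner_eval t0) v).
Proof.
move=> [F [_ EZ]] d0 Zv v0; apply/EZ; split=> // p Fp.
have [q Eq] := mpoly_along_curve p (v 0).
have Eqv t : q.[t] = p.@[map_mx (horner_eval t) v 0].
  by rewrite Eq; apply: meval_eq => i; rewrite mxE.
have /eqP : d * q = 0.
  apply: poly_vanish => t; rewrite hornerM.
  have [-> | dt] := eqVneq d.[t] 0; first by rewrite mul0r.
  by have /EZ[_ /(_ _ Fp)] := Zv t dt; rewrite Eqv => ->; rewrite mulr0.
by rewrite mulf_eq0 (negPf d0) /= -Eqv => /eqP ->; rewrite horner0.
Qed.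

End Pluecker.

(** * Pairs of symmetric matrices *)

Section SymmetricPairs.

Variables (R : comNzRingType) (q : nat).
Implicit Types (Y : 'M[R]_(q.+1, q.+3)) (Phi Z : 'M[R]_(q.+1, q.+2)).

(** For [Y = A *m J] these two truncations are the pairings of [A] with [L] under the two forms; see
    [trunc0_mulJ] and [trunc1_mulJ]. *)
Definition trunc0 Y : 'M[R]_(q.+1, q.+2) := colsub (widen_ord (leqnSn _)) Y.
Definition trunc1 Y : 'M[R]_(q.+1, q.+2) := colsub (lift ord0) Y.

(** If [Z] is the pairing of [B] with an isotropic [L], this is the change of the Gram matrix of [B]
    when [Phi *m L] is added to [B]; isotropy of [L] removes the quadratic term. *)
Definition polar Phi Z : 'M[R]_q.+1 := Phi *m Z^T + Z *m Phi^T.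

(* A pair of symmetric matrices of size r has r(r+1) free entries; they fill
   an r x (r+1) matrix. *)
Definition sym_pair (S0 S1 : 'M[R]_q.+1) : 'M[R]_(q.+1, q.+2) :=
  \matrix_(a, c) if (c <= a)%N then S0 a (inord c) else S1 a (inord c.-1).

Definition polar_pair Y Phi := sym_pair (polar Phi (trunc0 Y)) (polar Phi (trunc1 Y)).

Lemma polar_sym Phi Z : (polar Phi Z)^T = polar Phi Z.
Proof. by rewrite /polar linearD /= !trmx_mul !trmxK addrC. Qed.

(** [sym_pair] stores the lower triangle of the first matrix and, shifted by one column, the upper
    triangle of the second, diagonals included. *)
Lemma sym_pair_inj (S0 S1 T0 T1 : 'M[R]_q.+1) :
  S0^T = S0 -> S1^T = S1 -> T0^T = T0 -> T1^T = T1 ->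
  sym_pair S0 S1 = sym_pair T0 T1 -> S0 = T0 /\ S1 = T1.
Proof.
move=> sS0 sS1 sT0 sT1 /matrixP E; split; apply/matrixP => i j.
  wlog ij : i j / (j <= i)%N.
    by case: (leqP j i) => [/[swap]|/ltnW /[swap]] /[apply] //; rewrite -[in X in X -> _]sS0 -[in X in X -> _]sT0 !mxE.
  have := E i (widen_ord (leqnSn _) j); rewrite !mxE /= ij.
  by rewrite inord_val.
wlog ij : i j / (i <= j)%N.
  by case: (leqP i j) => [/[swap]|/ltnW /[swap]] /[apply] //; rewrite -[in X in X -> _]sS1 -[in X in X -> _]sT1 !mxE.
have := E i (lift ord0 j); rewrite !mxE /= leqNgt /bump /= add1n ltnS ij /=.
by rewrite inord_val.
Qed.

Lemma sym_pair_linear a S0 S1 T0 T1 :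
  sym_pair (a *: S0 + T0) (a *: S1 + T1) = a *: sym_pair S0 S1 + sym_pair T0 T1.
Proof. by apply/matrixP => i j; rewrite !mxE; case: ifP. Qed.

Lemma polar_linear Z : linear (polar^~ Z).
Proof.
move=> a P P'; rewrite /polar mulmxDl linearD /= linearZ /= mulmxDr.
by rewrite -scalemxAl -scalemxAr scalerDr addrACA.
Qed.

Fact polar_pair_is_linear Y : linear (polar_pair Y).
Proof. by move=> a P P'; rewrite /polar_pair !polar_linear sym_pair_linear. Qed.

HB.instance Definition _ Y :=
  GRing.isLinear.Build R 'M[R]_(q.+1, q.+2) 'M[R]_(q.+1, q.+2) _ (polar_pair Y)
    (polar_pair_is_linear Y).

Definition polar_mx Y : 'M[R]_(q.+1 * q.+2) := lin_mx (polar_pair Y).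

Lemma mul_polar_mx Y Phi : mxvec Phi *m polar_mx Y = mxvec (polar_pair Y Phi).
Proof. exact: mul_vec_lin. Qed.

End SymmetricPairs.

Section MapSymmetricPairs.

Variables (R S : comNzRingType) (f : {rmorphism R -> S}) (q : nat).

Lemma map_trunc0 (Y : 'M[R]_(q.+1, q.+3)) : map_mx f (trunc0 Y) = trunc0 (map_mx f Y).
Proof. by apply/matrixP => i j; rewrite !mxE. Qed.

Lemma map_trunc1 (Y : 'M[R]_(q.+1, q.+3)) : map_mx f (trunc1 Y) = trunc1 (map_mx f Y).
Proof. by apply/matrixP => i j; rewrite !mxE. Qed.

Lemma map_sym_pair (S0 S1 : 'M[R]_q.+1) :
  map_mx f (sym_pair S0 S1) = sym_pair (map_mx f S0) (map_mx f S1).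
Proof. by apply/matrixP => i j; rewrite !mxE; case: ifP => _; rewrite ?mxE. Qed.

Lemma map_polar_mx (Y : 'M[R]_(q.+1, q.+3)) :
  map_mx f (polar_mx Y) = polar_mx (map_mx f Y).
Proof.
apply: map_lin_mx => Phi; rewrite /polar_pair map_sym_pair /polar !map_mxD.
by rewrite !map_mxM -!map_trmx map_trunc0 map_trunc1.
Qed.

End MapSymmetricPairs.

(** * Degrees of matrices of forms *)

Section HomogeneousMatrices.

Variables (k : comNzRingType) (N : nat).

Definition homog_mx d m n (A : 'M[{mpoly k[N]}]_(m, n)) :=
  forall i j, A i j \is d.-homog.

Lemma homog_mxD d m n (A B : 'M_(m, n)) :
  homog_mx d A -> homog_mx d B -> homog_mx d (A + B).
Proof. by move=> hA hB i j; rewrite mxE rpredD. Qed.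

Lemma homog_mxN d m n (A : 'M_(m, n)) : homog_mx d A -> homog_mx d (- A).
Proof. by move=> hA i j; rewrite mxE rpredN. Qed.

Lemma homog_tr d m n (A : 'M_(m, n)) : homog_mx d A -> homog_mx d A^T.
Proof. by move=> hA i j; rewrite mxE. Qed.

Lemma homog_mulmx d e m n p (A : 'M_(m, n)) (B : 'M_(n, p)) :
  homog_mx d A -> homog_mx e B -> homog_mx (d + e) (A *m B).
Proof. by move=> hA hB i j; rewrite mxE rpred_sum // => l _; apply: dhomogM. Qed.

Lemma homog_scalemx d e m n a (A : 'M_(m, n)) :
  a \is d.-homog -> homog_mx e A -> homog_mx (d + e) (a *: A).
Proof. by move=> ha hA i j; rewrite mxE dhomogM. Qed.

Lemma homog_const m n (A : 'M[k]_(m, n)) : homog_mx 0 (map_mx (@mpolyC N k) A).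
Proof.
by move=> i j; rewrite mxE -[_%:MP]mulr1 mul_mpolyC; apply/dhomogZ/dhomog1.
Qed.

Lemma homog_prod (I : eqType) (s : seq I) d (F : I -> {mpoly k[N]}) :
  (forall i, F i \is d.-homog) -> \prod_(i <- s) F i \is (size s * d).-homog.
Proof.
move=> hF; elim: s => [|a s IH]; first by rewrite big_nil dhomog1.
by rewrite big_cons mulSn dhomogM.
Qed.

Lemma homog_det d n (A : 'M_n) : homog_mx d A -> \det A \is (n * d).-homog.
Proof.
move=> hA; rewrite rpred_sum // => s _; rewrite rpredMsign.
have := @homog_prod _ (index_enum 'I_n) d (fun i => A i (s i)) (fun i => hA i _).
by rewrite [size _](_ : _ = n) // -[RHS]card_ord cardT enumT.
Qed.

Lemma homog_adj d n (A : 'M_n) : homog_mx d A -> homog_mx (n.-1 * d) (\adj A).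
Proof.
move=> hA i j; rewrite mxE /cofactor rpredMsign; apply: homog_det => a b.
by rewrite !mxE.
Qed.

Lemma homog_minors d r n (A : 'M_(r, n)) :
  homog_mx d A -> homog_mx (r * d) (minors A).
Proof. by move=> hA i j; rewrite mxE; apply: homog_det => a b; rewrite mxE. Qed.

Lemma homog_mxvec d m n (A : 'M_(m, n)) : homog_mx d A -> homog_mx d (mxvec A).
Proof. by move=> hA i j; case/mxvec_indexP: j => a b; rewrite ord1 mxvecE. Qed.

Lemma homog_vec_mx d m n (A : 'rV_(m * n)) : homog_mx d A -> homog_mx d (vec_mx A).
Proof. by move=> hA i j; rewrite mxE. Qed.

Lemma homog_sym_pair d q (S0 S1 : 'M_q.+1) :
  homog_mx d S0 -> homog_mx d S1 -> homog_mx d (sym_pair S0 S1).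
Proof. by move=> h0 h1 i j; rewrite mxE; case: ifP. Qed.

Lemma homog_polar_mx d q (Y : 'M_(q.+1, q.+3)) : homog_mx d Y -> homog_mx d (polar_mx Y).
Proof.
move=> hY i j; rewrite mxE /=.
have h0 : homog_mx 0 (vec_mx (delta_mx 0 i) : 'M[{mpoly k[N]}]_(q.+1, q.+2)).
  apply: homog_vec_mx => a b; rewrite mxE; case: (_ && _).
    exact: dhomog1.
  exact: dhomog0.
have hp Z : homog_mx d Z -> homog_mx d (polar (vec_mx (delta_mx 0 i)) Z).
  move=> hZ; apply: homog_mxD.
    by rewrite -(add0n d); apply: homog_mulmx => //; apply: homog_tr.
  by rewrite -(addn0 d); apply: homog_mulmx => //; apply: homog_tr.
apply: homog_mxvec; apply: homog_sym_pair; apply: hp => a b.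
  by rewrite /trunc0 mxE.
by rewrite /trunc1 mxE.
Qed.

End HomogeneousMatrices.

(** * Hankel matrices and the linear system *)

Section HankelInjectivity.

Variables (k : fieldType) (q : nat).

(* [s] and [t] are without common zero as binary forms of degree [q + 2]. *)
Definition coprime_forms (s t : {poly k}) :=
  [&& (size s <= q.+3)%N, (size t <= q.+3)%N, coprimep s t
    & (size s == q.+3) || (size t == q.+3)].

Variables (s t : {poly k}).
Hypothesis st : coprime_forms s t.

Let sizes : (size s <= q.+3)%N. Proof. by case/and4P: st. Qed.
Let sizet : (size t <= q.+3)%N. Proof. by case/and4P: st. Qed.

(** The form of full degree [q + 2] is coprime to the other one, hence divides the other one's
    coefficient, which has degree at most [q + 1]. *)
Lemma syzygy0 (a b : {poly k}) : (size a <= q.+2)%N -> (size b <= q.+2)%N ->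
  a * s + b * t = 0 -> a = 0 /\ b = 0.
Proof.
case/and4P: st => _ _ cst /orP sz sa sb E.
have H (u v c d : {poly k}) : coprimep u v -> size u = q.+3 ->
    (size d <= q.+2)%N -> c * u + d * v = 0 -> c = 0 /\ d = 0.
  move=> cuv szu szd E'.
  have u0 : u != 0 by rewrite -size_poly_eq0 szu.
  have /(dvdp_leq _) ud : u %| d.
    rewrite -(Gauss_dvdpl _ cuv); move/eqP: E'; rewrite addr_eq0 => /eqP E'.
    by rewrite -dvdpNr -E' dvdp_mull.
  have d0 : d = 0 by apply/eqP; apply: contraTT szd => /ud; rewrite szu -ltnNge.
  move: E'; rewrite d0 mul0r addr0 => /eqP; rewrite mulf_eq0 (negPf u0) orbF.
  by move/eqP.
case: sz => /eqP sz; first exact: (H s t).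
by rewrite addrC in E; rewrite coprimep_sym in cst; have [] := H t s b a cst sz sa E.
Qed.

(** In terms of binary forms, the part of degree [2q + 2] of the ideal of [s] and [t]. *)
Definition in_ideal (p : {poly k}) :=
  exists a b : {poly k}, [/\ (size a <= q.+1)%N, (size b <= q.+1)%N & p = a * s + b * t].

(** By [syzygy0] the coefficients of ['X^j * p] are those of [p] times ['X^j]; for [j > q] they
    exceed degree [q] unless they are zero. *)
Lemma shifts_in_ideal (p : {poly k}) J : (q < J)%N ->
  (forall j, (j <= J)%N -> in_ideal ('X^j * p)) -> p = 0.
Proof.
move=> qJ hp; have [a [b [sa sb Ep]]] := hp 0 isT.
rewrite expr0 mul1r in Ep.
have main j : (j <= J)%N ->
    (size ('X^j * a)%R <= q.+1)%N /\ (size ('X^j * b)%R <= q.+1)%N.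
  elim: j => [|j IH] jJ; first by rewrite expr0 !mul1r.
  have [IHa IHb] := IH (ltnW jJ); have [a' [b' [sa' sb' E]]] := hp _ jJ.
  have sX (c : {poly k}) : (size ('X^j * c)%R <= q.+1)%N -> (size ('X^(j.+1) * c)%R <= q.+2)%N.
    move=> sc; rewrite exprS -mulrA (leq_trans (size_polyMleq _ _)) //.
    by rewrite size_polyX; lia.
  have [] := @syzygy0 ('X^(j.+1) * a - a') ('X^(j.+1) * b - b').
  - by rewrite (leq_trans (size_polyD _ _)) // geq_max sX // size_polyN ltnW.
  - by rewrite (leq_trans (size_polyD _ _)) // geq_max sX // size_polyN ltnW.
  - by rewrite !mulrBl addrACA -opprD -E Ep mulrDr !mulrA subrr.
  by move=> /eqP; rewrite subr_eq0 => /eqP -> /eqP; rewrite subr_eq0 => /eqP ->.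
have z (c : {poly k}) : (size ('X^J * c)%R <= q.+1)%N -> c = 0.
  have [-> //|c0] := eqVneq c 0.
  have := c0; rewrite -size_poly_gt0 => cs.
  by rewrite mulrC size_mulXn // => H; lia.
have [/z Ea /z Eb] := main J (leqnn _).
by rewrite Ep Ea Eb !mul0r addr0.
Qed.

Definition functional (e : nat -> k) (p : {poly k}) := \sum_(i < (q.*2).+3) p`_i * e i.

Let comb (v : 'rV[k]_(q.+1 + q.+1)) : {poly k} :=
  rVpoly (lsubmx v) * s + rVpoly (rsubmx v) * t.

Let comb_linear : linear comb.
Proof.
by move=> a u v; rewrite /comb !linearP /= !mulrDl -!scalerAl scalerDr addrACA.
Qed.

(** By [syzygy0] the ideal has dimension [2q + 2] in a space of dimension [2q + 3], so it is a
    hyperplane, cut out by a nonzero column of the cokernel. *)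
Lemma exists_functional : exists e, forall p : {poly k}, (size p <= (q.*2).+3)%N ->
  functional e p = 0 <-> in_ideal p.
Proof.
pose f := fun v => poly_rV (comb v) : 'rV[k]_(q.*2).+3.
have lf : linear f by move=> a u v; rewrite /f comb_linear linearP.
pose ff : {linear 'rV_(q.+1 + q.+1) -> 'rV_(q.*2).+3} :=
  HB.pack f (GRing.isLinear.Build k _ _ _ f lf).
pose S := lin1_mx ff.
have Sv v : v *m S = f v by rewrite mul_rV_lin1.
have scomb v : (size (comb v) <= (q.*2).+3)%N.
  have szM (w : 'rV[k]_q.+1) (c : {poly k}) : (size c <= q.+3)%N ->
      (size (rVpoly w * c)%R <= (q.*2).+3)%N.
    move=> sc; rewrite (leq_trans (size_polyMleq _ _)) //.
    have : (size (rVpoly w) <= q.+1)%N by exact: size_poly.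
    lia.
  by rewrite (leq_trans (size_polyD _ _)) // geq_max !szM.
have inS (p : {poly k}) : (size p <= (q.*2).+3)%N -> (poly_rV p <= S)%MS <-> in_ideal p.
  move=> sp; split.
    case/submxP => v; rewrite Sv => /(congr1 rVpoly).
    rewrite !poly_rV_K // => ->; exists (rVpoly (lsubmx v)), (rVpoly (rsubmx v)).
    by split=> //; apply: size_poly.
  move=> [a [b [sa sb ->]]]; apply/submxP; exists (row_mx (poly_rV a) (poly_rV b)).
  by rewrite Sv /f /comb row_mxKl row_mxKr !poly_rV_K.
have fS : row_free S.
  rewrite -kermx_eq0; apply/rowV0P => v /sub_kermxP; rewrite Sv => /(congr1 rVpoly).
  rewrite poly_rV_K // linear0.
  have sr (w : 'rV[k]_q.+1) : (size (rVpoly w) <= q.+2)%N.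
    by rewrite ltnW // ltnS size_poly.
  move=> /(syzygy0 (sr _) (sr _))[/(congr1 (@poly_rV _ q.+1)) + /(congr1 (@poly_rV _ q.+1))].
  by rewrite !rVpolyK !linear0 => El Er; rewrite -[v]hsubmxK El Er row_mx0.
have rS : \rank S = (q.*2).+2 by rewrite (eqP fS); lia.
have [C SC /matrix0Pn[i0 [j0 nz]]] : exists2 C : 'M_((q.*2).+3), S *m C = 0 & C != 0.
  exists (cokermx S); first exact: mulmx_coker.
  by rewrite -mxrank_eq0 mxrank_coker rS subSnn.
pose e0 := col j0 C.
have Se0 : S *m e0 = 0 by rewrite /e0 colE mulmxA SC mul0mx.
have re0 : \rank e0 = 1.
  apply/eqP; rewrite eqn_leq rank_leq_col lt0n mxrank_eq0.
  by apply: contraNneq nz => /matrixP/(_ i0 0); rewrite !mxE => ->.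
have kS : (kermx e0 <= S)%MS.
  have le : (S <= kermx e0)%MS by apply/sub_kermxP.
  by rewrite -(mxrank_leqif_sup le) rS mxrank_ker re0 subn1.
exists (fun i => e0 (inord i) 0) => p sp.
have -> : functional (fun i => e0 (inord i) 0) p = (poly_rV p *m e0) 0 0.
  by rewrite mxE; apply: eq_bigr => i _; rewrite inord_val [in RHS]mxE.
rewrite -inS //; split => [E|].
  by apply: submx_trans kS; apply/sub_kermxP/matrixP => i j; rewrite !ord1 E mxE.
by case/submxP => v ->; rewrite -mulmxA Se0 mulmx0 mxE.
Qed.

Lemma functional_ideal e : (forall p : {poly k}, (size p <= (q.*2).+3)%N ->
    functional e p = 0 <-> in_ideal p) ->
  forall (p : {poly k}) J, (q < J)%N -> (size p + J <= (q.*2).+3)%N ->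
  (forall j, (j <= J)%N -> functional e ('X^j * p) = 0) -> p = 0.
Proof.
move=> he p J qJ sp h; apply: (shifts_in_ideal qJ) => j jJ; apply/he; last exact: h.
by rewrite (leq_trans (size_polyMleq _ _)) // size_polyXn; lia.
Qed.

Hypothesis two0 : (2%:R : k) != 0.

Lemma antisymmetric_eq0 (x : k) : x + x = 0 -> x = 0.
Proof. by rewrite -mulr2n -mulr_natl => /eqP; rewrite mulf_eq0 (negPf two0) => /eqP. Qed.

(* The two antisymmetries together make [G] constant along antidiagonals, hence
   symmetric. *)
Lemma hankel_antisymmetric (G : nat -> nat -> k) :
  (forall a b, (a <= q)%N -> (b <= q)%N -> G a b + G b a = 0) ->
  (forall a b, (a <= q)%N -> (b <= q)%N -> G a b.+1 + G b a.+1 = 0) ->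
  forall a b, (a <= q)%N -> (b <= q.+1)%N -> G a b = 0.
Proof.
move=> h0 h1.
have shift d a b : (a + d <= q)%N -> (b + d <= q.+1)%N -> G a (b + d)%N = G (a + d)%N b.
  elim: d a b => [|d IH] a b ad bd; first by rewrite !addn0.
  rewrite !addnS -(addSn a d) -IH; [|lia|lia].
  apply/eqP; rewrite -subr_eq0 -[X in _ - X]opprK opprK.
  have E1 := h1 a (b + d)%N; have E0 := h0 a.+1 (b + d)%N.
  have -> : G a (b + d).+1 = - G (b + d)%N a.+1.
    by apply/eqP; rewrite -addr_eq0 E1 //; lia.
  by rewrite -opprD addrC E0 ?oppr0 //; lia.
have main a b : (a <= q)%N -> (b <= q)%N -> G a b = 0.
  wlog ab : a b / (a <= b)%N.
    move=> W aq bq; case: (leqP a b) => [/W -> //|/ltnW /W H].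
    by have := h0 a b aq bq; rewrite H // addr0.
  move=> aq bq; apply: antisymmetric_eq0; rewrite -[in RHS](h0 a b aq bq).
  congr (_ + _); have := shift (b - a)%N a a.
  by rewrite subnKC // => -> //; lia.
move=> a b aq; rewrite leq_eqVlt => /orP[/eqP ->|]; last by exact: main.
(* In the last column, the corner [a = q] gives [2 * G q q.+1 = 0], and for [a < q] the partner
   [G q a.+1] is already zero. *)
have := h1 a q aq (leqnn _); move: aq; rewrite leq_eqVlt => /orP[/eqP ->|aq].
  by move/antisymmetric_eq0.
by rewrite (main q a.+1) // addr0.
Qed.

(* The rows of [Y] span the functionals [p |-> functional e ('X^a * p)], where
   [functional e] has kernel the ideal of [s] and [t] in degree [2 q + 2]; hence [Y]
   is equivalent to a Hankel matrix. *)
Lemma polar_pair_inj (Y : 'M[k]_(q.+1, q.+3)) (Phi : 'M[k]_(q.+1, q.+2)) :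
  row_free Y -> Y *m (poly_rV s)^T = 0 -> Y *m (poly_rV t)^T = 0 ->
  polar Phi (trunc0 Y) = 0 -> polar Phi (trunc1 Y) = 0 -> Phi = 0.
Proof.
move=> fY Ys Yt P0 P1; have [e he] := exists_functional.
pose H : 'M[k]_(q.+1, q.+3) := \matrix_(a, c) e (a + c)%N.
have feXn a (p : {poly k}) m : (size p <= m)%N -> (a + m <= (q.*2).+3)%N ->
    functional e ('X^a * p) = \sum_(c < m) p`_c * e (a + c)%N.
  move=> sp am; rewrite /functional.
  rewrite -(big_mkord xpredT (fun i => ('X^a * p)`_i * e i)).
  rewrite (big_cat_nat (n := a)) //=; last by lia.
  rewrite big_nat_cond big1 ?add0r => [|i /andP[/andP[_ ia] _]]; last first.
    by rewrite coefXnM ia mul0r.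
  rewrite (big_cat_nat (n := (a + m)%N)) //=; last by lia.
  rewrite [X in _ + X]big_nat_cond [X in _ + X]big1 ?addr0; last first.
    move=> i /andP[/andP[ia _] _]; rewrite coefXnM ltnNge.
    rewrite (_ : (a <= i)%N) /=; last by lia.
    by rewrite nth_default ?mul0r // (leq_trans sp) //; lia.
  rewrite -{1}[a]add0n big_addn addKn big_mkord; apply: eq_bigr => i _.
  by rewrite coefXnM ltnNge leq_addl /= addnK addnC.
have HX (p : {poly k}) : (size p <= q.+3)%N ->
    H *m (poly_rV p)^T = \col_a functional e ('X^a * p).
  move=> sp; apply/colP => a; rewrite !mxE (feXn _ _ q.+3) //; last first.
    by have := ltn_ord a; lia.
  by apply: eq_bigr => c _; rewrite !mxE mulrC.
have idl (c : {poly k}) (a : 'I_q.+1) : (size c <= q.+3)%N ->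
   in_ideal ('X^a * c) -> functional e ('X^a * c) = 0.
  move=> sc; apply: (he _ _).2; rewrite (leq_trans (size_polyMleq _ _)) // size_polyXn.
  by have := ltn_ord a; lia.
have sX (a : 'I_q.+1) : (size ('X^a : {poly k}) <= q.+1)%N by rewrite size_polyXn.
have Hs : H *m (poly_rV s)^T = 0.
  rewrite HX //; apply/colP => a; rewrite !mxE; apply: idl => //.
  by exists 'X^a, 0; rewrite sX size_poly0 mul0r addr0.
have Ht : H *m (poly_rV t)^T = 0.
  rewrite HX //; apply/colP => a; rewrite !mxE; apply: idl => //.
  by exists 0, 'X^a; rewrite sX size_poly0 mul0r add0r.
(* [s] and [t] are independent, so by dimension the rows of [Y] span the whole annihilator of both,
   which contains the rows of [H]. *)
pose K := row_mx (poly_rV s : 'rV_q.+3)^T (poly_rV t : 'rV_q.+3)^T.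
have rK : \rank K = 2.
  rewrite -mxrank_tr; apply/eqP; rewrite -[_ == _]/(row_free K^T) -kermx_eq0.
  apply/rowV0P => v /sub_kermxP; rewrite /K tr_row_mx !trmxK -[v]hsubmxK.
  rewrite mul_row_col [lsubmx v]mx11_scalar [rsubmx v]mx11_scalar !mul_scalar_mx.
  move/(congr1 rVpoly); rewrite linearD !linearZ /= !poly_rV_K // linear0.
  rewrite -!mul_polyC => /syzygy0[||/eqP + /eqP].
  - by rewrite (leq_trans (size_polyC_leq1 _)).
  - by rewrite (leq_trans (size_polyC_leq1 _)).
  rewrite !polyC_eq0 => /eqP -> /eqP ->.
  by rewrite !raddf0 row_mx0.
have YK : (Y :=: kermx K)%MS.
  apply/eqmxP; rewrite -(mxrank_leqif_eq (_ : (Y <= kermx K)%MS)).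
    by rewrite (eqP fY) mxrank_ker rK.
  by apply/sub_kermxP; rewrite mul_mx_row Ys Yt row_mx0.
have /submxP[P HP] : (H <= Y)%MS.
  by rewrite YK; apply/sub_kermxP; rewrite mul_mx_row Hs Ht row_mx0.
(* A relation between the rows of [H] is a polynomial of degree at most [q] whose products with all
   powers up to [q + 2] are killed by the functional. *)
have fH : row_free H.
  rewrite -kermx_eq0; apply/rowV0P => u /sub_kermxP uH.
  rewrite -[u]rVpolyK (functional_ideal he (p := rVpoly u) (J := q.+2)) ?linear0 //.
    have : (size (rVpoly u) <= q.+1)%N by exact: size_poly.
    lia.
  move=> j jq; rewrite (feXn _ _ q.+1); [|exact: size_poly|lia].
  have E := congr1 (fun M : 'M[k]_(1, q.+3) => M 0 (inord j)) uH.
  rewrite !mxE in E.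
  rewrite -[RHS]E; apply: eq_bigr => c _.
  by rewrite coef_rVpoly_ord mxE inordK // addnC.
have uP : P \in unitmx.
  by rewrite -row_free_unit -row_leq_rank -{1}(eqP fH) HP mxrankM_maxl.
pose Psi := P *m Phi.
have T0 : trunc0 H = P *m trunc0 Y.
  by rewrite HP; apply/matrixP => i j; rewrite !mxE; apply: eq_bigr => l _; rewrite !mxE.
have T1 : trunc1 H = P *m trunc1 Y.
  by rewrite HP; apply/matrixP => i j; rewrite !mxE; apply: eq_bigr => l _; rewrite !mxE.
have polP Z : polar Psi (P *m Z) = P *m polar Phi Z *m P^T.
  by rewrite /polar /Psi !trmx_mul !mulmxDr mulmxDl !mulmxA.
pose phi (a : nat) := rVpoly (row (inord a) Psi).
have sphi a : (size (phi a) <= q.+2)%N by exact: size_poly.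
(* For [Psi] and [H] the two polar equations read [G a b + G b a = 0] and
   [G a b.+1 + G b a.+1 = 0]. *)
pose G a b := functional e ('X^b * phi a).
have GE (a b : nat) : (a <= q)%N -> (b <= q.+1)%N ->
    G a b = \sum_(c < q.+2) Psi (inord a) c * e (b + c)%N.
  move=> aq bq; rewrite /G (feXn _ _ q.+2) //; last by lia.
  by apply: eq_bigr => c _; rewrite coef_rVpoly_ord mxE.
have G0 : forall a b, (a <= q)%N -> (b <= q.+1)%N -> G a b = 0.
  apply: hankel_antisymmetric => a b aq bq.
    have : polar Psi (trunc0 H) = 0 by rewrite T0 polP P0 mulmx0 mul0mx.
    move/(congr1 (fun M : 'M[k]_q.+1 => M (inord a) (inord b))); rewrite !mxE => E.
    rewrite -[RHS]E !GE //; try lia.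
    congr (_ + _); apply: eq_bigr => c _; rewrite !mxE /= inordK //.
    by rewrite mulrC.
  have : polar Psi (trunc1 H) = 0 by rewrite T1 polP P1 mulmx0 mul0mx.
  move/(congr1 (fun M : 'M[k]_q.+1 => M (inord a) (inord b))); rewrite !mxE => E.
  rewrite -[RHS]E !GE //; try lia.
  congr (_ + _); apply: eq_bigr => c _; rewrite !mxE /= inordK // /bump add1n addSnnS //.
  by rewrite mulrC.
have Psi0 : Psi = 0.
  apply/row_matrixP => a; rewrite row0 -[row a Psi]rVpolyK -[a]inord_val.
  rewrite -/(phi a) (functional_ideal he (p := phi a) (J := q.+1)) ?linear0 //.
    by have := sphi a; lia.
  by move=> j jq; apply: G0 => //; rewrite -ltnS.
by rewrite -[Phi](mulKmx uP) -/Psi Psi0 mulmx0.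
Qed.


End HankelInjectivity.

Section PolarUnit.

Variables (k : fieldType) (q : nat).
Implicit Types (Y : 'M[k]_(q.+1, q.+3)) (Phi : 'M[k]_(q.+1, q.+2)).

Lemma polar_mx_unitP Y :
  (forall Phi, polar Phi (trunc0 Y) = 0 -> polar Phi (trunc1 Y) = 0 -> Phi = 0) <->
  polar_mx Y \in unitmx.
Proof.
split=> [inj | uY Phi P0 P1].
  rewrite -row_free_unit -kermx_eq0; apply/rowV0P => v /sub_kermxP.
  rewrite -[v]vec_mxK mul_polar_mx => /(congr1 (@vec_mx _ _ _)).
  rewrite mxvecK linear0 => E; rewrite (inj (vec_mx v)) ?linear0 //.
    have [] // := @sym_pair_inj _ _ _ _ 0 0 (polar_sym (vec_mx v) (trunc0 Y))
      (polar_sym (vec_mx v) (trunc1 Y)) (trmx0 _ _ _) (trmx0 _ _ _).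
    rewrite -[LHS]/(polar_pair Y (vec_mx v)) E.
    by apply/matrixP => i j; rewrite !mxE; case: ifP.
  have [] // := @sym_pair_inj _ _ _ _ 0 0 (polar_sym (vec_mx v) (trunc0 Y))
    (polar_sym (vec_mx v) (trunc1 Y)) (trmx0 _ _ _) (trmx0 _ _ _).
  rewrite -[LHS]/(polar_pair Y (vec_mx v)) E.
  by apply/matrixP => i j; rewrite !mxE; case: ifP.
rewrite -[Phi]mxvecK -[mxvec Phi](mulmxK uY) mul_polar_mx /polar_pair P0 P1.
rewrite (_ : sym_pair 0 0 = 0) ?linear0 ?mul0mx ?linear0 //.
by apply/matrixP => i j; rewrite !mxE; case: ifP.
Qed.

(** Invertibility depends only on the row space of [Y]: substituting [P *m Phi] for [Phi] turns both
    polar matrices into congruent ones. *)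
Lemma polar_mx_unitM (P : 'M[k]_q.+1) Y : P \in unitmx ->
  polar_mx Y \in unitmx -> polar_mx (P *m Y) \in unitmx.
Proof.
move=> uP /polar_mx_unitP inj; apply/polar_mx_unitP => Phi.
have -> : trunc0 (P *m Y) = P *m trunc0 Y.
  by apply/matrixP => i j; rewrite !mxE; apply: eq_bigr => l _; rewrite !mxE.
have -> : trunc1 (P *m Y) = P *m trunc1 Y.
  by apply/matrixP => i j; rewrite !mxE; apply: eq_bigr => l _; rewrite !mxE.
have polP Z : polar (P *m (invmx P *m Phi)) (P *m Z) =
    P *m polar (invmx P *m Phi) Z *m P^T.
  by rewrite /polar !trmx_mul !mulmxDr mulmxDl !mulmxA.
rewrite -[Phi](mulKVmx uP) !polP => P0 P1.
have cancel M : P *m M *m P^T = 0 -> M = 0.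
  move=> /(congr1 (mulmx (invmx P))); rewrite mulmx0 -mulmxA mulKmx // => E.
  by rewrite -[M](mulmxK (_ : P^T \in unitmx)) ?unitmx_tr // E mul0mx.
by rewrite (inj _ (cancel _ P0) (cancel _ P1)) mulmx0.
Qed.

End PolarUnit.

(** * Residue weights *)

Section Weights.

Variables (k : closedFieldType) (N : nat) (lambda : 'I_N -> k).
Hypothesis lambda_inj : injective lambda.

(* Up to scaling, [kap i ^+ 2] is the inverse of the derivative of
   [\prod_j ('X - lambda j)] at [lambda i]: the sum below is a sum of residues. *)
Lemma exists_weights : exists kap : 'I_N -> k, (forall i, kap i != 0) /\
  forall p : {poly k}, (size p < N)%N -> \sum_i kap i ^+ 2 * p.[lambda i] = 0.
Proof.
case: (posnP N) => [N0 | Npos].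
  by exists (fun=> 0); split=> [[i iN]|p sp]; exfalso; lia.
(* A Vandermonde matrix with one column fewer than rows has a nonzero left kernel vector [c]. *)
pose V : 'M[k]_(N, N.-1) := \matrix_(i, j) lambda i ^+ j.
have /rowV0Pn[c /sub_kermxP cV c0] : kermx V != 0.
  rewrite kermx_eq0 -row_leq_rank -ltnNge.
  by apply: leq_ltn_trans (rank_leq_col _) _; rewrite prednK.
have sumc (p : {poly k}) : (size p < N)%N -> \sum_i c 0 i * p.[lambda i] = 0.
  move=> sp; have sp' : (size p <= N.-1)%N by lia.
  transitivity (\sum_(j < N.-1) p`_j * (c *m V) 0 j).
    under eq_bigr => i _ do rewrite (horner_coef_wide _ sp') big_distrr.
    rewrite exchange_big; apply: eq_bigr => j _ /=; rewrite mxE big_distrr /=.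
    by apply: eq_bigr => i _; rewrite mxE mulrCA.
  by rewrite cV big1 // => j _; rewrite mxE mulr0.
(* If [c 0 i0] vanished, the polynomial with roots at all nodes but those of [i0] and [i1] would
   force [c 0 i1 = 0] for every [i1]. *)
have cn0 i0 : c 0 i0 != 0.
  apply: contraNneq c0 => ci0; apply/eqP/rowP => i1; rewrite [RHS]mxE.
  have [-> //|i10] := eqVneq i1 i0.
  pose p := \prod_(j <- enum (predC (pred2 i0 i1))) ('X - (lambda j)%:P).
  have sp : (size p < N)%N.
    rewrite size_prod_XsubC -cardE; have := cardC (pred2 i0 i1).
    rewrite card2 (eq_sym i0) i10 card_ord; move: #|predC _| => m. lia.
  have pn0 : p.[lambda i1] != 0.
    rewrite horner_prod prodf_seq_neq0; apply/allP => j; rewrite mem_enum !inE negb_or.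
    case/andP => _ ji1 /=; rewrite hornerXsubC subr_eq0.
    by apply: contraNneq ji1 => /lambda_inj ->.
  have := sumc p sp; rewrite (bigD1 i1) //= big1 ?addr0 => [/eqP|j ji1].
    by rewrite mulf_eq0 (negPf pn0) orbF => /eqP.
  have [->|ji0] := eqVneq j i0; first by rewrite ci0 mul0r.
  rewrite [p.[_]](_ : _ = 0) ?mulr0 //; apply/eqP; rewrite -[_ == 0]/(root p _).
  rewrite /p -(big_map lambda predT (fun x => 'X - x%:P)) root_prod_XsubC.
  by apply: map_f; rewrite mem_enum !inE negb_or ji0.
have sqrt (x : k) : exists y, y ^+ 2 = x.
  have /closed_rootP[y] : size ('X^2 - x%:P) != 1 by rewrite size_XnsubC.
  by rewrite rootE hornerD hornerN hornerC hornerXn subr_eq0 => /eqP <-; exists y.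
have [kap Ek] := fin_all_exists (fun i => sqrt (c 0 i)).
exists kap; split=> [i|p sp]; last by rewrite -[RHS](sumc p sp); under eq_bigr => i _ do rewrite Ek.
by apply: contraNneq (cn0 i) => ki; rewrite -Ek ki expr0n.
Qed.


End Weights.

(** * Isotropic complements of a fixed isotropic subspace *)

Section IsotropicGraph.

Variables (R : comNzRingType) (q N : nat).
Variables (C : 'M[R]_(q.+3, N)) (L : 'M[R]_(q.+2, N)) (D : 'M[R]_N).

(** The numerator of the solution of the isotropy system: the adjugate in place of the inverse keeps
    the entries polynomial in [Y]. *)
Definition graph_shift (Y : 'M[R]_(q.+1, q.+3)) : 'M[R]_(q.+1, q.+2) :=
  vec_mx (mxvec (sym_pair (Y *m C *m (Y *m C)^T) (Y *m C *m D *m (Y *m C)^T))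
    *m \adj (polar_mx Y)).

(* The isotropic subspace in the affine space of complements of the row space
   of [L] lying over [Y], by Cramer's rule. *)
Definition isotropic_graph (Y : 'M[R]_(q.+1, q.+3)) : 'M[R]_(q.+1, N) :=
  \det (polar_mx Y) *: (Y *m C) - graph_shift Y *m L.

End IsotropicGraph.

Lemma map_isotropic_graph (R S : comNzRingType) (f : {rmorphism R -> S}) q N
    (C : 'M[R]_(q.+3, N)) (L : 'M[R]_(q.+2, N)) (D : 'M[R]_N) Y :
  map_mx f (isotropic_graph C L D Y) =
  isotropic_graph (map_mx f C) (map_mx f L) (map_mx f D) (map_mx f Y).
Proof.
rewrite /isotropic_graph /graph_shift map_mxB map_mxZ !map_mxM map_vec_mx !map_mxM.
by rewrite map_mxvec map_sym_pair !map_mxM -!map_trmx !map_mxM map_mx_adj map_polar_mx -det_map_mx map_polar_mx.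
Qed.

(** With [m = (q + 1)(q + 2)] both terms have degree [m + 1]: determinant times [Y] gives [m + 1],
    Gram entries times adjugate give [2 + (m - 1)]. *)
Lemma homog_isotropic_graph (k : comNzRingType) n q N (C : 'M[k]_(q.+3, N))
    (L : 'M[k]_(q.+2, N)) (D : 'M[k]_N) (Y : 'M[{mpoly k[n]}]_(q.+1, q.+3)) :
  homog_mx 1 Y ->
  homog_mx (q.+1 * q.+2).+1 (isotropic_graph (map_mx (@mpolyC n k) C)
    (map_mx (@mpolyC n k) L) (map_mx (@mpolyC n k) D) Y).
Proof.
move=> hY; have hB : homog_mx 1 (Y *m map_mx (@mpolyC n k) C).
  by rewrite -(addn0 1%N); apply: homog_mulmx hY (homog_const _ _).
apply: homog_mxD.
  rewrite -addn1; apply: homog_scalemx => //.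
  by rewrite -[X in X.-homog]muln1; apply/homog_det/homog_polar_mx.
apply: homog_mxN; rewrite -[_.+1]addn0; apply: homog_mulmx (homog_const _ _).
apply: homog_vec_mx.
rewrite [X in homog_mx X](_ : _ = (1 + 1) + (q.+1 * q.+2).-1 * 1)%N; last by lia.
apply: homog_mulmx; last by apply/homog_adj/homog_polar_mx.
apply: homog_mxvec; apply: homog_sym_pair; first exact/homog_mulmx/homog_tr.
by apply: homog_mulmx (homog_tr hB); rewrite -(addn0 1%N); apply: homog_mulmx hB (homog_const _ _).
Qed.

(** * The polynomial model of the two forms *)

Section Setup.

Variables (k : closedFieldType) (q N : nat) (lambda kap : 'I_N -> k).
Hypothesis hN : N = (q.*2 + 5)%N.
Hypothesis lambda_inj : injective lambda.
Hypothesis kap0 : forall i, kap i != 0.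
Hypothesis residues :
  forall p : {poly k}, (size p < N)%N -> \sum_i kap i ^+ 2 * p.[lambda i] = 0.

Definition lambda_mx := diag_mx (\row_i lambda i).
(* In the coordinates [w i = kap i * h.[lambda i]] the space is [k[x] / (f)], where
   [f] has the roots [lambda i], and the forms are the residues of [h ^+ 2 / f] and
   [x * h ^+ 2 / f]. Then [low_degree] spans the polynomials of degree at most
   [q + 1], and [w *m poly_pairing] lists the residues of [x ^ j * h / f]. *)
Definition poly_pairing : 'M[k]_(N, q.+3) := \matrix_(i, j) (kap i * lambda i ^+ j).
Definition low_degree : 'M[k]_(q.+2, N) := \matrix_(j, i) (kap i * lambda i ^+ j).

Local Notation D := lambda_mx.
Local Notation J := poly_pairing.
Local Notation L := low_degree.

Definition isotropic m (A : 'M[k]_(m, N)) := A *m A^T = 0 /\ A *m D *m A^T = 0.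

Lemma mulD m (A : 'M[k]_(m, N)) i j : (A *m D) i j = A i j * lambda j.
Proof. by rewrite mul_mx_diag !mxE. Qed.

Lemma residuesX a : (a < N.-1)%N -> \sum_i kap i ^+ 2 * lambda i ^+ a = 0.
Proof.
move=> aN; rewrite -[RHS](residues (p := 'X^a)) ?size_polyXn; last by lia.
by apply: eq_bigr => i _; rewrite hornerXn.
Qed.

Lemma trunc0_mulJ (A : 'M[k]_(q.+1, N)) : trunc0 (A *m J) = A *m L^T.
Proof. by apply/matrixP => i j; rewrite !mxE; apply: eq_bigr => l _; rewrite !mxE. Qed.

Lemma trunc1_mulJ (A : 'M[k]_(q.+1, N)) : trunc1 (A *m J) = A *m D *m L^T.
Proof.
apply/matrixP => i j; rewrite [LHS]mxE [LHS]mxE [RHS]mxE; apply: eq_bigr => l _.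
by rewrite mulD !mxE /= /bump add1n exprS -mulrA; congr (_ * _); rewrite mulrCA.
Qed.

Lemma LJ : L *m J = 0.
Proof.
apply/matrixP => i j; rewrite !mxE -[RHS](@residuesX (i + j)%N).
  by apply: eq_bigr => l _; rewrite !mxE mulrACA -expr2 exprD.
by have := (ltn_ord i, ltn_ord j) => -[]; lia.
Qed.

(** A product of two polynomials of degree at most [q + 1], even times [x], has degree at most
    [2q + 3 < N - 1], so its residues sum to zero. *)
Lemma isotropicL : isotropic L.
Proof.
split; apply/matrixP => i j; rewrite [LHS]mxE [RHS]mxE.
  rewrite -[RHS](@residuesX (i + j)%N); last by have := (ltn_ord i, ltn_ord j) => -[]; lia.
  by apply: eq_bigr => l _; rewrite !mxE mulrACA -expr2 exprD.
rewrite -[RHS](@residuesX (i + j).+1); last by have := (ltn_ord i, ltn_ord j) => -[]; lia.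
apply: eq_bigr => l _; rewrite mulD !mxE expr2 exprS exprD -(mulrA (kap l)) mulrACA.
by rewrite (mulrC _ (lambda l)) -(mulrA (lambda l)).
Qed.

Lemma eval_inj m (p : {poly k}) : (size p <= m)%N -> (m <= N)%N ->
  (forall i, kap i * p.[lambda i] = 0) -> p = 0.
Proof.
move=> sp mN h; apply/eqP; apply: contraTT (leq_trans sp mN) => p0.
rewrite -ltnNge -[X in (X < _)%N](card_ord N) cardE -(size_map lambda).
apply: max_poly_roots p0 _ _; last by rewrite map_inj_uniq ?enum_uniq.
apply/allP => _ /mapP[i _ ->]; rewrite rootE; have /eqP := h i.
by rewrite mulf_eq0 (negPf (kap0 i)).
Qed.

Lemma coefL m (v : 'rV[k]_m) (M : 'M[k]_(m, N)) :
  (forall j i, M j i = kap i * lambda i ^+ j) ->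
  forall i, (v *m M) 0 i = kap i * (rVpoly v).[lambda i].
Proof.
move=> hM i; rewrite mxE (horner_coef_wide _ (_ : size _ <= m)%N); last exact: size_poly.
by rewrite big_distrr; apply: eq_bigr => j _ /=; rewrite hM coef_rVpoly_ord mulrCA.
Qed.

Lemma eval_row_free m (M : 'M[k]_(m, N)) : (m <= N)%N ->
  (forall j i, M j i = kap i * lambda i ^+ j) -> row_free M.
Proof.
move=> mN hM; rewrite -kermx_eq0; apply/rowV0P => v /sub_kermxP vM.
rewrite -[v]rVpolyK (@eval_inj m (rVpoly v)) ?linear0 //; first exact: size_poly.
by move=> i; rewrite -(coefL v hM) vM mxE.
Qed.

Lemma L_free : row_free L.
Proof. by apply: eval_row_free => [|j i]; [lia | rewrite mxE]. Qed.

Lemma J_full : row_full J.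
Proof.
rewrite /row_full -mxrank_tr -/(row_free _).
by apply: eval_row_free => [|j i]; [lia | rewrite !mxE].
Qed.

(** [L] lies in the kernel of [J] and has the same dimension [q + 2]; so [J] presents the quotient
    by [L]. *)
Lemma kerJ m (A : 'M[k]_(m, N)) : A *m J = 0 -> (A <= L)%MS.
Proof.
move=> AJ; have LK : (L <= kermx J)%MS by apply/sub_kermxP; exact: LJ.
have KL : (kermx J <= L)%MS.
  rewrite -(mxrank_leqif_sup LK) (eqP L_free) mxrank_ker.
  by rewrite (eqP J_full); lia.
by apply: submx_trans KL; apply/sub_kermxP.
Qed.


Variable C : 'M[k]_(q.+3, N).
Hypothesis CJ : C *m J = 1%:M.

Local Notation graph := (isotropic_graph C L D).

Lemma graphJ Y : graph Y *m J = \det (polar_mx Y) *: Y.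
Proof. by rewrite mulmxBl -scalemxAl -!mulmxA CJ mulmx1 LJ mulmx0 subr0. Qed.

(** [A] differs from its lift [B = A *m J *m C] by some [Phi *m L], and isotropy of [A] is a linear
    system for [Phi] with matrix [polar_mx]; multiplying by the adjugate solves it up to the
    determinant. *)
Lemma graph_unique A : isotropic A ->
  graph (A *m J) = \det (polar_mx (A *m J)) *: A.
Proof.
move=> [A0 A1]; set Y := A *m J.
have [B EB] : {B | B = Y *m C} by exists (Y *m C).
have BJ : B *m J = Y by rewrite EB -mulmxA CJ mulmx1.
have /submxP[Phi EPhi] : (A - B <= L)%MS by apply: kerJ; rewrite mulmxBl BJ subrr.
have EA : A = B + Phi *m L by rewrite -EPhi addrC subrK.
have [L0 L1] := isotropicL.
have BL0 : trunc0 Y = B *m L^T by rewrite -BJ trunc0_mulJ.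
have BL1 : trunc1 Y = B *m D *m L^T by rewrite -BJ trunc1_mulJ.
have DT : D^T = D by rewrite tr_diag_mx.
have E : polar_pair Y Phi = - sym_pair (B *m B^T) (B *m D *m B^T).
  rewrite /polar_pair (_ : polar _ (trunc0 Y) = - (B *m B^T)); last first.
    apply/eqP; rewrite -addr_eq0 addrC; apply/eqP; rewrite -[RHS]A0 EA.
    rewrite /polar BL0 linearD /= !trmx_mul trmxK !(mulmxDl, mulmxDr).
    rewrite -!mulmxA (mulmxA L) L0 mul0mx mulmx0 addr0 addrA.
    by rewrite -!addrA; congr (_ + _); rewrite addrC !mulmxA.
  rewrite (_ : polar _ (trunc1 Y) = - (B *m D *m B^T)); last first.
    apply/eqP; rewrite -addr_eq0 addrC; apply/eqP; rewrite -[RHS]A1 EA.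
    rewrite /polar BL1 linearD /= !trmx_mul DT trmxK !(mulmxDl, mulmxDr).
    rewrite -!mulmxA !(mulmxA L D) (mulmxA (L *m D) L^T) L1 mul0mx mulmx0 addr0 addrA.
    by rewrite -!addrA; congr (_ + _); rewrite addrC !mulmxA.
  by apply/matrixP => i j; rewrite !mxE; case: ifP.
rewrite /isotropic_graph /graph_shift -EB.
rewrite (_ : sym_pair _ _ = - polar_pair Y Phi); last by rewrite E opprK.
rewrite linearN mulNmx linearN /= -mul_polar_mx -mulmxA mul_mx_adj mul_mx_scalar.
by rewrite linearZ /= mxvecK mulNmx opprK -scalemxAl -scalerDr -EA.
Qed.

(** With [d] the determinant, each Gram matrix expands to [d] times the difference of [d] times that
    of [B] and the polar matrix of [Phi], which agree by the choice of [graph_shift]. *)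
Lemma graph_isotropic Y : \det (polar_mx Y) != 0 -> isotropic (graph Y).
Proof.
move=> d0; set d := \det _ in d0; rewrite /isotropic_graph -/d.
have [B EB] : {B | B = Y *m C} by exists (Y *m C).
have [Phi EPhi] : {Phi | Phi = graph_shift C D Y} by exists (graph_shift C D Y).
rewrite -EPhi -EB; have BJ : B *m J = Y by rewrite EB -mulmxA CJ mulmx1.
have [L0 L1] := isotropicL.
have BL0 : trunc0 Y = B *m L^T by rewrite -BJ trunc0_mulJ.
have BL1 : trunc1 Y = B *m D *m L^T by rewrite -BJ trunc1_mulJ.
have DT : D^T = D by rewrite tr_diag_mx.
have E : polar_pair Y Phi = d *: sym_pair (B *m B^T) (B *m D *m B^T).
  apply: (can_inj mxvecK); rewrite -mul_polar_mx EPhi /graph_shift -EB vec_mxK.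
  by rewrite -mulmxA mul_adj_mx mul_mx_scalar linearZ.
have [P0 P1] : polar Phi (trunc0 Y) = d *: (B *m B^T) /\
    polar Phi (trunc1 Y) = d *: (B *m D *m B^T).
  apply: sym_pair_inj; rewrite ?polar_sym //.
  - by rewrite linearZ /= trmx_mul trmxK.
  - by rewrite linearZ /= !trmx_mul trmxK DT mulmxA.
  by rewrite -/(polar_pair Y Phi) E; apply/matrixP => i j; rewrite !mxE; case: ifP.
have XX (X Y' Z : 'M[k]_(q.+1)) : X = d *: Y' -> d *: (d *: Y') - d *: X = 0.
  by move=> ->; rewrite subrr.
split; rewrite linearB /= linearZ /= trmx_mul !(mulmxBl, mulmxBr).
  rewrite -!scalemxAl -!scalemxAr -!mulmxA (mulmxA L) L0 mul0mx mulmx0 subr0.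
  rewrite -(XX _ _ 0 P0) /polar BL0 !trmx_mul trmxK scalerDr opprD.
  by rewrite -!mulmxA; rewrite -!addrA; congr (_ + _); rewrite addrC.
rewrite -!scalemxAl -!scalemxAr -!mulmxA !(mulmxA L D) (mulmxA (L *m D) L^T) L1 mul0mx mulmx0 subr0.
rewrite -(XX _ _ 0 P1) /polar BL1 !trmx_mul trmxK DT scalerDr opprD.
by rewrite -!mulmxA; rewrite -!addrA; congr (_ + _); rewrite addrC.
Qed.

End Setup.

(** * Conics of isotropic subspaces *)

Section BilinearForm.

Variables (k : fieldType) (N : nat) (M : 'M[k]_N).
Implicit Types u v : 'rV[k]_N.

Definition bform u v : k := (u *m M *m v^T) 0 0.

Lemma bformDl u u' v : bform (u + u') v = bform u v + bform u' v.
Proof. by rewrite /bform !mulmxDl mxE. Qed.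

Lemma bformZl a u v : bform (a *: u) v = a * bform u v.
Proof. by rewrite /bform -!scalemxAl mxE. Qed.

Lemma bformDr u v v' : bform u (v + v') = bform u v + bform u v'.
Proof. by rewrite /bform linearD /= mulmxDr mxE. Qed.

Lemma bformZr a u v : bform u (a *: v) = a * bform u v.
Proof. by rewrite /bform linearZ /= -scalemxAr mxE. Qed.

Lemma bformC u v : M^T = M -> bform u v = bform v u.
Proof. by move=> sM; rewrite /bform -[in LHS](trmxK (_ *m v^T)) mxE !trmx_mul trmxK sM mulmxA. Qed.

Lemma bform0P m (A : 'M[k]_(m, N)) v :
  (forall u, (u <= A)%MS -> bform u v = 0) <-> A *m M *m v^T = 0.
Proof.
split=> [h | h u /submxP[w ->]].
  apply/row_matrixP => i; rewrite row0 !row_mul; apply/rowP => j.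
  by rewrite ord1 [RHS]mxE; apply: h; apply: row_sub.
by rewrite /bform -!mulmxA (mulmxA A) h mulmx0 mxE.
Qed.

Lemma bform_sub m m' (A : 'M[k]_(m, N)) (B : 'M[k]_(m', N)) u v :
  A *m M *m B^T = 0 -> (u <= A)%MS -> (v <= B)%MS -> bform u v = 0.
Proof.
move=> AB uA /submxP[w ->]; move: u uA; apply/bform0P.
by rewrite trmx_mul mulmxA AB mul0mx.
Qed.

Lemma bform_mx0 m (A : 'M[k]_(m, N)) :
  (forall w w', bform (w *m A) (w' *m A) = 0) -> A *m M *m A^T = 0.
Proof.
move=> h; apply/matrixP => i j; rewrite [RHS]mxE -[RHS](h (delta_mx 0 i) (delta_mx 0 j)).
rewrite /bform -!rowE -row_mul mxE [RHS]mxE; apply: eq_bigr => l _.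
by rewrite !mxE.
Qed.

End BilinearForm.

Section ConicMove.

Variables (k : closedFieldType) (N : nat) (lambda : 'I_N -> k).
Hypothesis two0 : (2%:R : k) != 0.
Hypothesis lambda_inj : injective lambda.

Local Notation D := (lambda_mx lambda).
Local Notation isotropic := (isotropic lambda).

(* The matrix of the member of the pencil which is singular at the [i]-th
   coordinate point. *)
Definition Dsing i : 'M[k]_N := D - (lambda i)%:M.
Definition coord_vec i : 'rV[k]_N := delta_mx 0 i.
Local Notation e_ := coord_vec.

Lemma mulDsing m (A : 'M[k]_(m, N)) i a j :
  (A *m Dsing i) a j = A a j * (lambda j - lambda i).
Proof. by rewrite mulmxBr mul_mx_scalar [LHS]mxE mulD !mxE mulrBr [_ * A a j]mulrC. Qed.

Lemma tr_Dsing i : (Dsing i)^T = Dsing i.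
Proof. by rewrite linearB /= tr_diag_mx tr_scalar_mx. Qed.

Lemma e_Dsing i : e_ i *m Dsing i = 0.
Proof.
apply/rowP => j; rewrite mulDsing !mxE eqxx /=.
by case: eqP => [->|]; rewrite ?subrr ?mulr0 ?mul0r.
Qed.

Lemma kerDsing i v : v *m Dsing i = 0 -> v = v 0 i *: e_ i.
Proof.
move=> v0; apply/rowP => j; rewrite !mxE eqxx /=.
have [->|ji] := eqVneq j i; first by rewrite mulr1.
have /(congr1 (fun w : 'rV[k]_N => w 0 j)) := v0; rewrite mulDsing mxE => /eqP.
rewrite mulf_eq0 subr_eq0 mulr0 => /orP[/eqP //|/eqP /lambda_inj E].
by rewrite E eqxx in ji.
Qed.

Lemma isotropic_Dsing m (A : 'M_(m, N)) i : isotropic A -> A *m Dsing i *m A^T = 0.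
Proof.
by case=> A0 A1; rewrite mulmxBr mulmxBl A1 mul_mx_scalar -scalemxAl A0 scaler0 subr0.
Qed.

Lemma isotropic_dot m (A : 'M_(m, N)) (u v : 'rV[k]_N) : isotropic A ->
  (u <= A)%MS -> (v <= A)%MS -> u *m v^T = 0.
Proof.
case=> A0 _ /submxP[a ->] /submxP[b ->].
by rewrite trmx_mul -!mulmxA (mulmxA A) A0 mul0mx mulmx0.
Qed.

Lemma mul_e (v : 'rV[k]_N) i : v *m (e_ i)^T = (v 0 i)%:M.
Proof.
apply/matrixP => a b; rewrite !ord1 !mxE (bigD1 i) //= big1 ?addr0 ?mulr1n => [|j ji].
  by rewrite !mxE !eqxx mulr1.
by rewrite !mxE (negPf ji) mulr0.
Qed.

Lemma e_notin m (A : 'M_(m, N)) i : isotropic A -> ~~ (e_ i <= A)%MS.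
Proof.
move=> iA; apply/negP => eA; have := isotropic_dot iA eA eA.
rewrite mul_e => /matrixP/(_ 0 0); rewrite !mxE !eqxx => /eqP.
by rewrite oner_eq0.
Qed.

Section Choice.

Variables (m m' : nat) (A : 'M[k]_(m, N)) (L : 'M[k]_(m', N)) (n : 'rV[k]_N) (i : 'I_N).
Hypotheses (iA : isotropic A) (iL : isotropic L).
Hypotheses (nA : (n <= A)%MS) (nL : (n <= L)%MS) (ni : n 0 i != 0).

Local Notation q := (bform (Dsing i)).

Let qAA u v : (u <= A)%MS -> (v <= A)%MS -> q u v = 0.
Proof. by apply: bform_sub; apply: isotropic_Dsing. Qed.

Let qLL u v : (u <= L)%MS -> (v <= L)%MS -> q u v = 0.
Proof. by apply: bform_sub; apply: isotropic_Dsing. Qed.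

Let q_sym u v : q u v = q v u. Proof. by apply: bformC; apply: tr_Dsing. Qed.

Let qel u : q (e_ i) u = 0.
Proof. by rewrite /bform e_Dsing mul0mx mxE. Qed.

Let qer u : q u (e_ i) = 0. Proof. by rewrite q_sym qel. Qed.

Let Ae_P u : (u <= A + e_ i)%MS -> exists w x, (w <= A)%MS /\ u = w + x *: e_ i.
Proof.
case/sub_addsmxP => -[a b] /= ->; exists (a *m A), (b 0 0); rewrite submxMl.
by split=> //; rewrite [b]mx11_scalar mul_scalar_mx mxE mulr1n.
Qed.

Let orth_tr (v : 'rV_N) : A *m Dsing i *m v^T = 0 <-> v *m Dsing i *m A^T = 0.
Proof.
by split=> /(congr1 trmx); rewrite !trmx_mul trmxK tr_Dsing trmx0 mulmxA.
Qed.

(** Write [l = w + x *: e_ i] and pair with [n]: isotropy of [A] and [L] leaves [x * n 0 i = 0]. *)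
Lemma sub_Ae (l : 'rV_N) : (l <= L)%MS -> (l <= A + e_ i)%MS -> (l <= A)%MS.
Proof.
move=> lL /Ae_P[w [x [wA El]]]; rewrite El.
have := isotropic_dot iL nL lL; rewrite El linearD /= mulmxDr (isotropic_dot iA nA wA).
rewrite add0r linearZ /= -scalemxAr mul_e => /matrixP/(_ 0 0); rewrite !mxE eqxx mulr1n.
by move/eqP; rewrite mulf_eq0 (negPf ni) orbF => /eqP ->; rewrite scale0r addr0.
Qed.

(* Exactly two maximal isotropic subspaces of the singular quadric contain
   [A + e_ i], each spanned by it and an isotropic [v]; vectors of [L] outside
   [A + e_ i] can lie in at most one of them, since the two [v] are not orthogonal. *)
Lemma exists_isotropic_direction : N = (m.*2 + 3)%N -> exists v : 'rV[k]_N,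
  [/\ v 0 i = 0, A *m Dsing i *m v^T = 0, q v v = 0, ~~ (v <= A + e_ i)%MS &
    forall l : 'rV_N, (l <= L)%MS -> (l <= A + e_ i + v)%MS -> (l <= A)%MS].
Proof.
move=> hN.
have AevP (v l : 'rV_N) : (l <= A + e_ i + v)%MS ->
    exists (u : 'rV_N) y, (u <= A + e_ i)%MS /\ l = u + y *: v.
  case/sub_addsmxP => -[a b] /= ->; exists (a *m (A + e_ i)%MS), (b 0 0).
  by rewrite submxMl; split=> //; rewrite [b]mx11_scalar mul_scalar_mx mxE mulr1n.
(* The vector [e_ i] is in the radical of [q], so subtracting a multiple of it normalizes [v 0 i] to
   zero and keeps the other conditions. *)
have finish v : A *m Dsing i *m v^T = 0 -> ~~ (v <= A + e_ i)%MS ->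
    q v v = 0 -> (forall (l u : 'rV_N) y, (l <= L)%MS -> (u <= A + e_ i)%MS ->
       l = u + y *: v -> (l <= A + e_ i)%MS) ->
    exists v : 'rV[k]_N, [/\ v 0 i = 0, A *m Dsing i *m v^T = 0, q v v = 0,
      ~~ (v <= A + e_ i)%MS &
      forall l : 'rV_N, (l <= L)%MS -> (l <= A + e_ i + v)%MS -> (l <= A)%MS].
  move=> Av nv qv hl; pose c := v 0 i; exists (v - c *: e_ i).
  have ce : (c *: e_ i <= A + e_ i)%MS by rewrite scalemx_sub // addsmxSr.
  split.
  - by rewrite !mxE !eqxx mulr1 subrr.
  - apply/bform0P => u uA; rewrite bformDr -scaleNr bformZr qer mulr0 addr0.
    exact: ((bform0P _ _ _).2 Av).
  - by rewrite -scaleNr !(bformDl, bformDr, bformZl, bformZr) qel qer qer qv !mulr0 !addr0.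
  - by apply: contra nv => h; rewrite -(subrK (c *: e_ i) v) addmx_sub.
  move=> l lL /AevP[u [y [uA El]]]; apply: sub_Ae => //.
  apply: (hl l (u - y *: (c *: e_ i)) y) => //; last by rewrite El scalerBr addrAC addrA addrAC.
  by rewrite addmx_sub // eqmx_opp scalemx_sub.
(* If some [l] in [L] is orthogonal to [A] but outside [A + e_ i], then [v] is taken not orthogonal
   to [l]; otherwise any isotropic [v] works. *)
have [case2 | /row_subPn[a]] :=
  boolP (L :&: kermx (Dsing i *m A^T) <= A + e_ i)%MS; last first.
  set l := row a _ => lAe.
  have : (l <= L :&: kermx (Dsing i *m A^T))%MS by apply: row_sub.
  rewrite sub_capmx => /andP[lL /sub_kermxP lA]; rewrite mulmxA in lA.
  (* This gives a linear functional, hence a vector [p], orthogonal to [A] but not to [l]. *)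
  have nsub : ~~ (l *m Dsing i <= col_mx (A *m Dsing i) (e_ i))%MS.
    apply: contra lAe => /submxP[w]; rewrite -[w]hsubmxK mul_row_col.
    set a1 := lsubmx w; set b := rsubmx w => E.
    have b0 : b = 0.
      have /(congr1 (fun M : 'rV[k]_N => M 0 i)) := E.
      rewrite mulDsing subrr mulr0 mulmxA [RHS]mxE mulDsing subrr mulr0 add0r.
      rewrite [b]mx11_scalar mul_scalar_mx !mxE !eqxx mulr1 => <-.
      by apply/matrixP => ? ?; rewrite !mxE mul0rn.
    move: E; rewrite b0 mul0mx addr0 mulmxA => /eqP; rewrite -subr_eq0 -mulmxBl.
    move/eqP/kerDsing => E; rewrite -(subrK (a1 *m A) l) E addmx_sub //.
      by rewrite scalemx_sub // addsmxSr.
    by rewrite (submx_trans (submxMl _ _)) // addsmxSl.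
  move: nsub; rewrite submxE => /matrix0Pn[a0 [j]]; rewrite ord1 => nz.
  pose p := (col j (cokermx (col_mx (A *m Dsing i) (e_ i))))^T.
  have lp : q l p != 0.
    by rewrite /bform /p trmxK colE mulmxA -colE mxE.
  have := mulmx_coker (col_mx (A *m Dsing i) (e_ i)); rewrite mul_col_mx => /eqP.
  rewrite col_mx_eq0 => /andP[/eqP Ap _].
  have {}Ap : A *m Dsing i *m p^T = 0 by rewrite /p trmxK colE mulmxA Ap mul0mx.
  (* [th] solves [q p p - 2 th q l p = 0], making [v] isotropic; as [q l l = 0], the pairing with
     [l] is unchanged. *)
  pose th := q p p / (2%:R * q l p); pose v := p - th *: l.
  have Al u : (u <= A)%MS -> q u l = 0.
    move=> uA; rewrite q_sym; move: uA => /submxP[w ->].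
    by rewrite /bform trmx_mul mulmxA lA mul0mx mxE.
  have lv : q l v = q l p.
    by rewrite /v bformDr -scaleNr bformZr (qLL lL lL) mulr0 addr0.
  have lAe0 u : (u <= A + e_ i)%MS -> q l u = 0.
    case/Ae_P => w [x [wA ->]]; rewrite bformDr bformZr qer mulr0 addr0.
    by rewrite q_sym Al.
  apply: (finish v).
  - apply/bform0P => u uA; rewrite /v bformDr -scaleNr bformZr Al // mulr0 addr0.
    by move: u uA; apply/bform0P.
  - by apply: contra lp => /lAe0; rewrite lv => ->.
  - rewrite /v !(bformDl, bformDr, bformZl, bformZr, =^~scaleNr) (qLL lL lL).
    rewrite (q_sym p l) !mulr0 addr0 /th; set x := q p p; set y := q l p.
    have y0 : y != 0 by exact: lp.
    by field; rewrite y0 two0.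
  (* [l] is orthogonal to [l'] and to [A + e_ i] but not to [v], so [y = 0]. *)
  move=> l' u y l'L uAe El; have := qLL lL l'L; rewrite El bformDr bformZr lv.
  rewrite lAe0 // add0r => /eqP; rewrite mulf_eq0 (negPf lp) orbF => /eqP ->.
  by rewrite scale0r addr0.
have iso2 (Y : 'M[k]_N) : (1 < \rank Y)%N ->
    exists v : 'rV_N, [/\ (v <= Y)%MS, v != 0 & q v v = 0].
  move=> rY; have /rowV0Pn[p1 p1Y p10] : Y != 0.
    by rewrite -mxrank_eq0 -lt0n ltnW.
  have [q1 | q1] := eqVneq (q p1 p1) 0; first by exists p1.
  have /row_subPn[a] : ~~ (Y <= p1)%MS.
    by apply: contraL rY => /mxrankS h; rewrite -leqNgt (leq_trans h) ?rank_leq_row.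
  set p2 := row a Y => p2p1; pose P := Poly [:: q p2 p2; 2%:R * q p1 p2; q p1 p1].
  have /closed_rootP[th] : size P != 1.
    by rewrite (@PolyK _ 0).
  rewrite rootE horner_Poly /= mul0r add0r => /eqP E.
  exists (p2 + th *: p1); split.
  - by rewrite addmx_sub ?scalemx_sub ?row_sub.
  - apply: contra p2p1; rewrite addr_eq0 => /eqP ->.
    by rewrite eqmx_opp scalemx_sub.
  rewrite !(bformDl, bformDr, bformZl, bformZr) (q_sym p2 p1) -[RHS]E; ring.
(* [X] has dimension at least [m + 2] and meets [A + e_ i] in dimension at most [m], as it misses
   [e_ i]; a complement has room for an isotropic vector. *)
pose X := kermx (row_mx (Dsing i *m A^T) (e_ i)^T).
have XP (v : 'rV_N) : (v <= X)%MS -> A *m Dsing i *m v^T = 0 /\ v 0 i = 0.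
  move/sub_kermxP; rewrite mul_mx_row => /eqP; rewrite row_mx_eq0 => /andP[/eqP vA].
  rewrite mul_e => /eqP/matrixP/(_ 0 0); rewrite !mxE mulr1n => vi; split=> //.
  by apply/orth_tr; rewrite -mulmxA.
have rX : (m + 2 <= \rank X)%N.
  by rewrite mxrank_ker; have := rank_leq_col (row_mx (Dsing i *m A^T) (e_ i)^T); lia.
have rcap : (\rank (X :&: (A + e_ i))%MS < \rank (A + e_ i)%MS)%N.
  rewrite ltn_neqAle mxrankS ?capmxSr // andbT; apply/negP => /eqP E.
  have /XP[_ /eqP] : (e_ i <= X)%MS.
    apply: submx_trans (addsmxSr A (e_ i)) _; apply: submx_trans (capmxSl X (A + e_ i)%MS).
    by rewrite -(mxrank_leqif_sup (capmxSr X (A + e_ i)%MS)) E.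
  by rewrite !mxE !eqxx oner_eq0.
have rAe : (\rank (A + e_ i)%MS <= m.+1)%N.
  rewrite (leq_trans (mxrank_adds_leqif _ _)) //.
  by have := rank_leq_row A; have := rank_leq_row (e_ i); lia.
have [] := iso2 (X :\: (A + e_ i)%MS)%MS.
  have := mxrank_cap_compl X (A + e_ i)%MS; lia.
move=> v [vX v0 qv]; have [Av vi] := XP v (submx_trans vX (diffmxSl _ _)).
apply: (finish v) => //.
  apply: contra v0 => vAe; rewrite -submx0 -(capmx_diff X (A + e_ i)%MS) sub_capmx.
  by rewrite vX.
move=> l u y lL /Ae_P[w [x [wA ->]]] El; apply: submx_trans case2.
rewrite sub_capmx lL; apply/sub_kermxP; rewrite mulmxA; apply/orth_tr/bform0P => u' u'A.
rewrite El !bformDr !bformZr qer (qAA u'A wA) ((bform0P _ _ _).2 Av) // !mulr0 !addr0 //.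
Qed.


End Choice.

Lemma isotropicE m (A : 'M_(m, N)) i :
  A *m A^T = 0 -> A *m Dsing i *m A^T = 0 -> isotropic A.
Proof.
move=> A0 Ai; split=> //; rewrite -[D](subrK (lambda i)%:M) mulmxDr mulmxDl.
by rewrite Ai mul_mx_scalar -scalemxAl A0 scaler0 addr0.
Qed.

Section Conic.

Variables (m : nat) (A : 'M[k]_(m, N)) (i : 'I_N) (v : 'rV[k]_N).

Let nu := (v *m v^T) 0 0.
Let al := A *m (e_ i)^T.
Let be := A *m v^T.

(* The member of parameter [t] of the ruling through [A] of the restriction of
   the first quadric to the span of [A], [e_ i] and [v]. *)
Definition conic (t : k) : 'M[k]_(m, N) :=
  (1 + nu * t ^+ 2) *: A + (2%:R * t) *: ((al - t *: be) *m v)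
    - (2%:R * t) *: ((be + (nu * t) *: al) *m e_ i).

Lemma conic0 : conic 0 = A.
Proof. by rewrite /conic expr0n mulr0 addr0 scale1r mulr0 !scale0r subr0 addr0. Qed.

Lemma conic_poly : exists B : 'M[{poly k}]_(m, N),
  forall t, map_mx (horner_eval t) B = conic t.
Proof.
pose c (M : 'M[k]_(m, N)) := map_mx (@polyC k) M.
pose B := (1 + nu%:P * 'X ^+ 2) *: c A
   + (2%:R%:P * 'X) *: (c (al *m v) - 'X *: c (be *m v))
    - (2%:R%:P * 'X) *: (c (be *m e_ i) + (nu%:P * 'X) *: c (al *m e_ i)).
exists B => t; rewrite /conic !mulmxBl !mulmxDl -!scalemxAl; apply/matrixP => a b.
by rewrite /B !mxE /horner_eval /= !hornerE.
Qed.

Lemma conic_row (w : 'rV[k]_m) t : exists x y, [/\ w *m conic t =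
    (1 + nu * t ^+ 2) *: (w *m A) + y *: v + x *: e_ i,
    y = 2%:R * t * ((w *m A) 0 i - t * (w *m A *m v^T) 0 0) &
    x = - (2%:R * t) * ((w *m A *m v^T) 0 0 + nu * t * (w *m A) 0 i)].
Proof.
eexists; eexists; split; try reflexivity.
have Eal : w *m al = ((w *m A) 0 i)%:M by rewrite mulmxA mul_e.
have Ebe : w *m be = ((w *m A *m v^T) 0 0)%:M by rewrite mulmxA -mx11_scalar.
rewrite /conic mulmxBr mulmxDr -!scalemxAr !mulmxA mulmxBr mulmxDr -!scalemxAr Eal Ebe.
rewrite mulmxBl mulmxDl -!scalemxAl !mul_scalar_mx.
move: (w *m A) (e_ i) (_ 0 i) (_ 0 0) nu => W e x y c.
by apply/rowP => j; rewrite !mxE; ring.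
Qed.

Hypotheses (iA : isotropic A) (vi : v 0 i = 0) (Av : A *m Dsing i *m v^T = 0).
Hypotheses (qv : bform (Dsing i) v v = 0) (vAe : ~~ (v <= A + e_ i)%MS).

(** The span of [A], [e_ i] and [v] is isotropic for [Dsing i], so only the first form uses the
    coefficients of the conic, through a polynomial identity in [t]. *)
Lemma conic_isotropic t : isotropic (conic t).
Proof.
have iAA (u u' : 'rV_N) : (u <= A)%MS -> (u' <= A)%MS -> bform 1%:M u u' = 0.
  by move=> uA uA'; rewrite /bform mulmx1 (isotropic_dot iA uA uA') mxE.
have b1C (u u' : 'rV[k]_N) : bform 1%:M u u' = bform 1%:M u' u by apply: bformC; apply: tr_scalar_mx.
have b1e u : bform 1%:M u (e_ i) = u 0 i by rewrite /bform mulmx1 mul_e mxE mulr1n.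
have b1e' u : bform 1%:M (e_ i) u = u 0 i by rewrite b1C b1e.
have qe u : bform (Dsing i) (e_ i) u = 0 by rewrite /bform e_Dsing mul0mx mxE.
have qe' u : bform (Dsing i) u (e_ i) = 0.
  by rewrite bformC ?qe //; apply: tr_Dsing.
have qAv (u : 'rV_N) : (u <= A)%MS -> bform (Dsing i) u v = 0 by move: u; apply/bform0P.
apply: (@isotropicE _ _ i).
  rewrite -[X in X *m _]mulmx1; apply: bform_mx0 => w w'.
  have [x [y [-> -> ->]]] := conic_row w t.
  have [x' [y' [-> -> ->]]] := conic_row w' t.
  have -> : (w *m A *m v^T) 0 0 = bform 1%:M (w *m A) v by rewrite /bform mulmx1.
  have -> : (w' *m A *m v^T) 0 0 = bform 1%:M (w' *m A) v by rewrite /bform mulmx1.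
  have vv : bform 1%:M v v = nu by rewrite /bform mulmx1.
  rewrite !(bformDl, bformDr, bformZl, bformZr) !b1e !b1e' vi vv.
  rewrite (iAA _ _ (submxMl w A) (submxMl w' A)) (b1C v (w' *m A)) [e_ i _ _]mxE !eqxx.
  move: ((w *m A) 0 i) ((w' *m A) 0 i) (bform _ (w *m A) v) (bform _ (w' *m A) v).
  by move=> a1 a2 b1 b2; rewrite /= !mulr1; ring.
apply: bform_mx0 => w w'.
have [x [y [-> _ _]]] := conic_row w t; have [x' [y' [-> _ _]]] := conic_row w' t.
have aA (u : 'rV_m) : (u *m A <= A)%MS by apply: submxMl.
rewrite !(bformDl, bformDr, bformZl, bformZr) !qe !qe' qv !qAv //.
rewrite (bformC v (w' *m A) (tr_Dsing i)) qAv //.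
by rewrite (bform_sub (isotropic_Dsing i iA)) // !mulr0 !addr0.
Qed.

Let AvP x y (u : 'rV_N) : (u <= A)%MS -> y *: v + x *: e_ i = u -> x = 0 /\ y = 0.
Proof.
move=> uA E; have y0 : y = 0.
  apply: contraNeq vAe => y0.
  have -> : v = y^-1 *: (u - x *: e_ i) by rewrite -E addrK scalerA mulVf ?scale1r.
  rewrite scalemx_sub // addmx_sub ?(submx_trans uA) ?addsmxSl //.
  by rewrite -scaleNr scalemx_sub // addsmxSr.
move: E; rewrite y0 scale0r add0r => E; split=> //.
apply: contraNeq (e_notin i iA) => x0.
by rewrite -[e_ i]scale1r -(mulVf x0) -scalerA E scalemx_sub.
Qed.

Lemma conic_row_free t : row_free A -> 1 + nu * t ^+ 2 != 0 -> row_free (conic t).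
Proof.
move=> fA a0; rewrite -kermx_eq0; apply/rowV0P => w /sub_kermxP.
have [x [y [-> _ _]]] := conic_row w t; rewrite -addrA => /eqP.
rewrite addrC addr_eq0 -scaleNr => /eqP E.
have [x0 y0] := AvP (scalemx_sub _ (submxMl w A)) E.
move: E; rewrite x0 y0 !scale0r addr0 => /esym/eqP.
rewrite scaler_eq0 oppr_eq0 (negPf a0) /= => /eqP wA.
by apply: (row_free_inj fA); rewrite wA mul0mx.
Qed.

(** By the choice of [v], a vector of [L] in the moved subspace lies in [A], so its components along
    [v] and [e_ i] vanish; this makes its [i]-th coordinate zero, which excludes [n]. *)
Lemma conic_cap m' (L : 'M[k]_(m', N)) (n : 'rV[k]_N) t :
  (n <= A)%MS -> (n <= L)%MS -> n 0 i != 0 ->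
  (forall l : 'rV_N, (l <= L)%MS -> (l <= A + e_ i + v)%MS -> (l <= A)%MS) ->
  t != 0 -> 1 + nu * t ^+ 2 != 0 ->
  (\rank (conic t :&: L)%MS < \rank (A :&: L)%MS)%N.
Proof.
move=> nA nL ni hL t0 a0.
have key (l : 'rV_N) : (l <= conic t)%MS -> (l <= L)%MS -> (l <= A)%MS /\ l 0 i = 0.
  case/submxP => w ->; have [x [y [-> Ey Ex]]] := conic_row w t => lL.
  have lA : (((1 + nu * t ^+ 2) *: (w *m A) + y *: v + x *: e_ i)%R <= A)%MS.
    refine (hL _ lL _); rewrite !addmx_sub ?scalemx_sub //.
    - by rewrite (submx_trans (submxMl _ _)) // -addsmxA addsmxSl.
    - by rewrite addsmxSr.
    - by rewrite (submx_trans (addsmxSr A _)) // addsmxSl.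
  split=> //; have wA := submxMl w A.
  have := @AvP x y _ (addmx_sub lA (scalemx_sub (- (1 + nu * t ^+ 2)) wA)).
  case=> [|x0 y0]; first by rewrite scaleNr -(addrA (_ *: (w *m A))) addrAC subrr add0r.
  move: Ey Ex; rewrite x0 y0 => Ey Ex.
  (* The vanishing of [x] and [y] is a linear system in [(w *m A) 0 i] and the product of [w *m A]
     with [v], of determinant [1 + nu * t ^+ 2] up to sign and the factors [2 t]. *)
  have wi : (w *m A) 0 i = 0.
    have t2 : 2%:R * t != 0 by rewrite mulf_neq0.
    move/esym/eqP: Ey; rewrite mulf_eq0 (negPf t2) subr_eq0 => /eqP Ea.
    move/esym/eqP: Ex; rewrite mulf_eq0 oppr_eq0 (negPf t2) addr_eq0 => /eqP Eb.
    have : (1 + nu * t ^+ 2) * (w *m A) 0 i = 0.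
      by rewrite mulrDl mul1r {1}Ea Eb; ring.
    by move/eqP; rewrite mulf_eq0 (negPf a0) => /eqP.
  by rewrite !scale0r !addr0 mxE wi mulr0.
have sub : (conic t :&: L <= A :&: L)%MS.
  apply/rV_subP => l; rewrite !sub_capmx => /andP[lc lL]; rewrite lL andbT.
  by have [] := key l lc lL.
suff : (conic t :&: L < A :&: L)%MS by rewrite ltmxErank => /andP[].
rewrite ltmxE sub /=; apply/negP => sub'.
have : (n <= conic t :&: L)%MS by apply: submx_trans sub'; rewrite sub_capmx nA.
by rewrite sub_capmx => /andP[nc _]; have [_ /eqP] := key n nc nL; rewrite (negPf ni).
Qed.

End Conic.


Lemma conic_move m m' (A : 'M[k]_(m, N)) (L : 'M[k]_(m', N)) :
  N = (m.*2 + 3)%N -> row_free A -> isotropic A -> isotropic L ->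
  (A :&: L)%MS != 0 ->
  exists (B : 'M[{poly k}]_(m, N)) (d : {poly k}),
    [/\ d != 0, map_mx (horner_eval 0) B = A &
      forall t, d.[t] != 0 -> let Bt := map_mx (horner_eval t) B in
        [/\ row_free Bt, isotropic Bt & (\rank (Bt :&: L)%MS < \rank (A :&: L)%MS)%N]].
Proof.
move=> hN fA iA iL /rowV0Pn[n]; rewrite sub_capmx => /andP[nA nL] n0.
have /matrix0Pn[z [i]] := n0; rewrite ord1 => ni.
have [v [vi Av qv vAe hL]] := exists_isotropic_direction iA iL nA nL ni hN.
have [B EB] := conic_poly A i v; pose nu := (v *m v^T) 0 0.
exists B, ('X * (1 + nu%:P * 'X ^+ 2)); split; last 1 first.
- move=> t; rewrite hornerM hornerX hornerD hornerM !hornerC hornerXn mulf_eq0 negb_or.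
  case/andP => t0 a0 /=; rewrite EB.
  split.
  - exact: (conic_row_free iA vAe fA a0).
  - exact: (conic_isotropic iA vi Av qv).
  exact: (conic_cap iA vAe nA nL ni hL t0 a0).
- rewrite mulf_neq0 ?polyX_eq0 //; apply/eqP => /(congr1 (horner^~ 0)).
  rewrite hornerD hornerM !hornerC hornerXn ?horner0 expr0n mulr0 addr0.
  by move/eqP; rewrite oner_eq0.
by rewrite EB conic0.
Qed.

End ConicMove.

(** * Density *)

Section Semicontinuity.

Variable k : fieldType.

Lemma map_horner_polyC m n (M : 'M[k]_(m, n)) t :
  map_mx (horner_eval t) (map_mx (@polyC k) M) = M.
Proof. by apply/matrixP => i j; rewrite !mxE /horner_eval hornerC. Qed.

(** [P] and [Q] compress the matrix at [t0] to the identity; where the determinant of the same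
    compression is nonzero, the rank is at least as large. *)
Lemma rank_semicontinuous m n (M : 'M[{poly k}]_(m, n)) t0 :
  exists d : {poly k}, d.[t0] != 0 /\ forall t, d.[t] != 0 ->
    (\rank (map_mx (horner_eval t0) M) <= \rank (map_mx (horner_eval t) M))%N.
Proof.
set M0 := map_mx _ M.
have /submxP[P EP] : (row_base M0 <= M0)%MS by rewrite eq_row_base.
have /row_freeP[Q EQ] := row_base_free M0.
pose d := \det (map_mx (@polyC k) P *m M *m map_mx (@polyC k) Q).
have Ed t : d.[t] = \det (P *m map_mx (horner_eval t) M *m Q).
  by rewrite -[d.[t]]/(horner_eval t d) -det_map_mx !map_mxM !map_horner_polyC.
exists d; split=> [|t]; rewrite Ed; first by rewrite -EP EQ det1 oner_eq0.
rewrite -unitfE -unitmxE => /mxrank_unit <-.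
by rewrite (leq_trans (mxrankM_maxl _ _)) // mxrankM_maxr.
Qed.

(** The sum with [L] does not shrink near [t0]; with the rank of [B] fixed, the intersection does
    not grow. *)
Lemma rank_cap_semicontinuous m m' n (B : 'M[{poly k}]_(m, n)) (L : 'M[k]_(m', n)) t0 :
  row_free (map_mx (horner_eval t0) B) ->
  exists d : {poly k}, d.[t0] != 0 /\ forall t, d.[t] != 0 ->
    row_free (map_mx (horner_eval t) B) ->
    (\rank (map_mx (horner_eval t) B :&: L)%MS <=
     \rank (map_mx (horner_eval t0) B :&: L)%MS)%N.
Proof.
move=> f0; have [d [d0 dt]] := rank_semicontinuous (col_mx B (map_mx (@polyC k) L)) t0.
exists d; split=> // t /dt; rewrite !map_col_mx !map_horner_polyC -!addsmxE => le ft.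
have := mxrank_sum_cap (map_mx (horner_eval t0) B) L.
have := mxrank_sum_cap (map_mx (horner_eval t) B) L.
by rewrite (eqP f0) (eqP ft); lia.
Qed.

(** [B] lies in its own orthogonal, whose dimension is [n] minus the rank of [B *m M]. *)
Lemma isotropic_bound m n (B : 'M[k]_(m, n)) (M : 'M[k]_n) :
  M^T = M -> row_free B -> B *m M *m B^T = 0 -> (m + \rank (B *m M)%R <= n)%N.
Proof.
move=> sM fB B0; have : (B <= kermx (M *m B^T))%MS by apply/sub_kermxP; rewrite mulmxA.
move/mxrankS; rewrite (eqP fB) mxrank_ker -[X in (_ - X)%N]mxrank_tr trmx_mul trmxK sM.
by rewrite leq_subRL ?rank_leq_col // addnC.
Qed.

End Semicontinuity.

Section Density.

Variables (k : closedFieldType) (q N : nat) (lambda kap : 'I_N -> k).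
Hypothesis hN : N = (q.*2 + 5)%N.
Hypothesis two0 : (2%:R : k) != 0.
Hypothesis lambda_inj : injective lambda.
Hypothesis kap0 : forall i, kap i != 0.
Hypothesis residues :
  forall p : {poly k}, (size p < N)%N -> \sum_i kap i ^+ 2 * p.[lambda i] = 0.

Local Notation D := (lambda_mx lambda).
Local Notation J := (poly_pairing q lambda kap).
Local Notation L := (low_degree q lambda kap).
Local Notation isotropic := (isotropic lambda).
Local Notation Dsing := (Dsing lambda).
Local Notation e_ := (coord_vec k).

Variable C : 'M[k]_(q.+3, N).
Hypothesis CJ : C *m J = 1%:M.

Definition reflection i : 'M[k]_N := diag_mx (\row_j if j == i then -1 else 1).

(** A single finite index for [L] and its images under one sign change lets the density induction
    sum all intersection dimensions. *)
Definition signed_L (o : option 'I_N) : 'M[k]_(q.+2, N) :=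
  if o is Some i then L *m reflection i else L.

Lemma isotropic_signed_L o : isotropic (signed_L o).
Proof.
have iL : isotropic L := isotropicL hN residues.
case: o => [i|] //; have [L0 L1] := iL.
have ST : (reflection i)^T = reflection i by rewrite tr_diag_mx.
have SS : reflection i *m reflection i = 1%:M.
  rewrite mulmx_diag; apply/matrixP => a b; rewrite !mxE.
  by case: (a == i); rewrite ?mulrNN mulr1.
have SDS : reflection i *m D *m reflection i = D.
  rewrite mulmx_diag mulmx_diag; apply/matrixP => a b; rewrite !mxE.
  by case: (a == i); rewrite ?mulN1r ?mulrN1 ?opprK ?mul1r ?mulr1.
split; rewrite /= trmx_mul ST.
  by rewrite -mulmxA (mulmxA (reflection i)) SS mul1mx.
by rewrite mulmxA -!mulmxA (mulmxA (reflection i) D) (mulmxA _ (reflection i)) SDS mulmxA.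
Qed.

Lemma mul_reflection i (u : 'rV[k]_N) : u *m reflection i = u - (2%:R * u 0 i) *: e_ i.
Proof.
apply/rowP => j; rewrite mul_mx_diag !mxE eqxx /=.
by case: eqP => [->|_]; rewrite /= ?mulr0 ?subr0 ?mulr1; ring.
Qed.

Lemma evL (p : {poly k}) i : (size p <= q.+2)%N -> (poly_rV p *m L) 0 i = kap i * p.[lambda i].
Proof. by move=> sp; rewrite (@coefL _ _ lambda kap) ?poly_rV_K // => j l; rewrite mxE. Qed.

Lemma evJ (p : {poly k}) i : (size p <= q.+3)%N -> (poly_rV p *m J^T) 0 i = kap i * p.[lambda i].
Proof. by move=> sp; rewrite (@coefL _ _ lambda kap) ?poly_rV_K // => j l; rewrite !mxE. Qed.

Section GeneralPosition.

Variable A : 'M[k]_(q.+1, N).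
Hypotheses (fA : row_free A) (iA : isotropic A).
Hypothesis AL : forall o, (A :&: signed_L o)%MS = 0.

Let iL : isotropic L. Proof. exact: isotropicL. Qed.

Lemma mulJ_row_free : row_free (A *m J).
Proof.
rewrite -kermx_eq0; apply/rowV0P => v /sub_kermxP; rewrite mulmxA => vAJ.
have vA : (v *m A <= A :&: L)%MS.
  by rewrite sub_capmx submxMl (kerJ hN lambda_inj kap0 residues).
have /eqP := AL None; rewrite /= -submx0 => /(submx_trans vA); rewrite submx0 => /eqP v0.
by apply: (row_free_inj fA); rewrite v0 mul0mx.
Qed.

(* An isotropic subspace [A + U] of dimension [q + 3] is too large for a
   nondegenerate form, and for a singular member of the pencil it contains the
   singular point, which forces [A] to meet a reflection of [L]. *)
Lemma no_common_zero (U : 'M[k]_(2, N)) mu : row_free U -> (U <= L)%MS ->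
  A *m U^T = 0 \/ A *m (D - mu%:M) *m U^T = 0 -> False.
Proof.
move=> fU UL.
pose B := col_mx A U.
have fB : row_free B.
  rewrite -row_leq_rank -addsmxE; have := mxrank_sum_cap A U.
  have : (A :&: U <= A :&: signed_L None)%MS by apply: capmxS.
  rewrite AL submx0 => /eqP ->; rewrite mxrank0 (eqP fA) (eqP fU); lia.
have UU M : L *m M *m L^T = 0 -> U *m M *m U^T = 0.
  by case/submxP: UL => w -> h; rewrite trmx_mul -!mulmxA (mulmxA L) (mulmxA (L *m M)) h mul0mx mulmx0.
have BB M : M^T = M -> A *m M *m A^T = 0 -> L *m M *m L^T = 0 ->
    A *m M *m U^T = 0 -> B *m M *m B^T = 0.
  move=> sM AA LL AU; have UA : U *m M *m A^T = 0.
    by have /(congr1 trmx) := AU; rewrite !trmx_mul trmxK sM trmx0 mulmxA.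
  by rewrite tr_col_mx mul_col_mx mul_col_row AA (UU M) // AU UA block_mx0.
have [A0 A1] := iA; have [L0 L1] := iL.
(* Twice the dimension [q + 3] exceeds [N = 2q + 5]. *)
have unitcase M : M^T = M -> M \in unitmx -> B *m M *m B^T = 0 -> False.
  move=> sM uM /(isotropic_bound sM fB).
  rewrite mxrankMfree ?row_free_unit // (eqP fB); lia.
case=> [AU | AU].
  apply: (unitcase 1%:M); rewrite ?trmx1 ?unitmx1 //.
  by apply: BB; rewrite ?trmx1 ?mulmx1.
have sM : (D - mu%:M)^T = D - mu%:M by rewrite linearB /= tr_diag_mx tr_scalar_mx.
have [|] := boolP (D - mu%:M \in unitmx).
  move/(unitcase _ sM); apply; apply: BB => //.
    by rewrite mulmxBr mulmxBl A1 mul_mx_scalar -scalemxAl A0 scaler0 subr0.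
  by rewrite mulmxBr mulmxBl L1 mul_mx_scalar -scalemxAl L0 scaler0 subr0.
rewrite unitmxE unitfE negbK.
have -> : D - mu%:M = diag_mx (\row_j (lambda j - mu)).
  by apply/matrixP => a b; rewrite !mxE -mulrnBl.
rewrite det_diag => /prodf_eq0[i _]; rewrite mxE subr_eq0 => /eqP Emu.
move: AU sM; rewrite -Emu -/(Dsing i) => AU sM {unitcase}.
have AA := isotropic_Dsing i iA; have LL := isotropic_Dsing i iL.
have B0 : B *m Dsing i *m B^T = 0 by apply: BB.
(* If [e_ i] were outside, adding it would give an isotropic subspace of dimension [q + 4] whose
   image under [Dsing i] has rank at least [q + 3], against [N = 2q + 5]. *)
have [eB | eB] := boolP (e_ i <= B)%MS; last first.
  have fBe : row_free (col_mx B (e_ i)).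
    rewrite -row_leq_rank -addsmxE; have := mxrank_sum_cap B (e_ i).
    have r1 : \rank (e_ i) = 1 by rewrite mxrank_delta.
    have : (\rank (B :&: e_ i)%MS < 1)%N.
      rewrite ltnNge; apply: contra eB => h; apply: submx_trans (capmxSl _ (e_ i)).
      by rewrite -(mxrank_leqif_sup (capmxSr _ _)) r1 eqn_leq h andbT -r1 mxrankS ?capmxSr.
    rewrite (eqP fB) r1; lia.
  have := isotropic_bound sM fBe; rewrite tr_col_mx mul_col_mx mul_col_row B0 e_Dsing.
  rewrite !mul0mx -[B *m _ *m (e_ i)^T]mulmxA -{1}(tr_Dsing lambda i) -trmx_mul e_Dsing trmx0 mulmx0.
  rewrite block_mx0 => /(_ erefl).
  have := mxrank_mul_ker (col_mx B (e_ i)) (Dsing i).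
  rewrite mul_col_mx e_Dsing (eqP fBe).
  have : (\rank (col_mx B (e_ i) :&: kermx (Dsing i))%MS <= 1)%N.
    apply: leq_trans (rank_leq_row (e_ i)); apply/mxrankS/rV_subP => v; rewrite sub_capmx => /andP[_ /sub_kermxP].
    by move/(kerDsing lambda_inj) ->; rewrite scalemx_sub.
  lia.
move: eB; rewrite -addsmxE => /sub_addsmxP[[a b] /= Ee].
have uL : (b *m U <= L)%MS by rewrite (submx_trans (submxMl _ _)).
have wA : (a *m A <= A)%MS by apply: submxMl.
move: (b *m U) (a *m A) uL wA Ee => u w uL wA Ee.
have Ew : w = e_ i - u by rewrite Ee addrK.
(* Both [u] and [w = e_ i - u] are isotropic for the first form, which fixes [u 0 i]; then [w] is
   minus the reflection of [u]. *)
have ui : 2%:R * u 0 i = 1.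
  have := isotropic_dot iA wA wA; rewrite Ew linearB /= mulmxBl !mulmxBr.
  rewrite (isotropic_dot iL uL uL) subr0 !mul_e.
  have -> : e_ i *m u^T = (u 0 i)%:M.
    by rewrite -[LHS]trmxK trmx_mul trmxK mul_e tr_scalar_mx.
  move/matrixP/(_ 0 0); rewrite !mxE !eqxx /= !mulr1n => /eqP.
  by rewrite -addrA -opprD subr_eq0 => /eqP E; rewrite mulr_natl mulr2n -E.
have wS : (w <= A :&: signed_L (Some i))%MS.
  rewrite sub_capmx wA /= Ew (_ : e_ i - u = - (u *m reflection i)).
    by rewrite eqmx_opp submxMr.
  by rewrite mul_reflection ui scale1r opprB.
move: wS; rewrite AL submx0 => /eqP w0.
by have /negP[] := e_notin i iL; rewrite Ee w0 add0r.
Qed.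

Lemma kernel_basis n (Y : 'M[k]_(q.+1, n)) : row_free Y -> n = q.+3 ->
  exists K : 'M[k]_(2, n), row_free K /\ Y *m K^T = 0.
Proof.
move=> fY En; have rK : \rank (kermx Y^T) = 2.
  by rewrite mxrank_ker mxrank_tr (eqP fY) En; lia.
have := (row_base_free (kermx Y^T), eq_row_base (kermx Y^T)).
move: (row_base _); rewrite rK => K [fK EK]; exists K; split=> //.
have /sub_kermxP/(congr1 trmx) : (K <= kermx Y^T)%MS by rewrite EK.
by rewrite trmx_mul trmxK trmx0.
Qed.

(** A kernel basis of [A *m J] is a pair of polynomials of degree at most [q + 2]. Dividing out a
    common root, or a common root at infinity, yields a plane in [L] excluded by [no_common_zero];
    so [polar_pair_inj] applies. *)
Lemma general_position_unit : polar_mx (A *m J) \in unitmx.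
Proof.
have fY := mulJ_row_free; have [K [fK YK]] := kernel_basis fY erefl.
pose p i := rVpoly (row i K).
have sp i : (size (p i) <= q.+3)%N by apply: size_poly.
have KJ i j : (K *m J^T) i j = kap j * (p i).[lambda j].
  have -> : (K *m J^T) i j = (row i K *m J^T) 0 j by rewrite -row_mul [RHS]mxE.
  by rewrite -evJ // rVpolyK.
have AK : A *m (K *m J^T)^T = 0 by rewrite trmx_mul trmxK mulmxA YK.
have fKJ : \rank (K *m J^T) = 2.
  rewrite mxrankMfree ?(eqP fK) //; rewrite -row_leq_rank mxrank_tr.
  by rewrite (eqP (J_full hN lambda_inj kap0)).
have U_L (s1 : 'I_2 -> {poly k}) : (forall i, size (s1 i) <= q.+2)%N ->
    ((\matrix_(i, j) (kap j * (s1 i).[lambda j]))%R <= L)%MS.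
  move=> ss; apply/row_subP => i; apply/submxP; exists (poly_rV (s1 i)).
  by apply/rowP => j; rewrite evL // !mxE.
have no_root mu : (forall i, root (p i) mu) -> False.
  move=> rp; pose s1 i := p i %/ ('X - mu%:P).
  have Es i : p i = s1 i * ('X - mu%:P) by rewrite divpK // dvdp_XsubCl.
  have ss i : (size (s1 i) <= q.+2)%N.
    rewrite size_divp ?polyXsubC_eq0 // size_XsubC leq_subLR; exact: sp.
  pose U := \matrix_(i, j) (kap j * (s1 i).[lambda j]).
  have EU : K *m J^T = U *m (D - mu%:M).
    apply/matrixP => i j; rewrite KJ mulmxBr mul_mx_scalar [RHS]mxE mulD.
    by rewrite [X in _ + X]mxE !mxE Es hornerM hornerXsubC; ring.
  apply: (@no_common_zero U mu); [|exact: U_L|right].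
    rewrite -row_leq_rank; apply: leq_trans (mxrankM_maxl U (D - mu%:M)).
    by rewrite -EU fKJ.
  have sM : (D - mu%:M)^T = D - mu%:M by rewrite linearB /= tr_diag_mx tr_scalar_mx.
  by rewrite -mulmxA -{1}sM -trmx_mul -EU.
(* A common root at infinity means that both degrees drop, so the pair itself lies in [L]. *)
have no_infty : (forall i, size (p i) <= q.+2)%N -> False.
  move=> ss; have EU : K *m J^T = \matrix_(i, j) (kap j * (p i).[lambda j]).
    by apply/matrixP => i j; rewrite KJ mxE.
  apply: (@no_common_zero (K *m J^T) 0); [|by rewrite EU U_L|by left].
  by rewrite -row_leq_rank fKJ.
have I2 (i : 'I_2) : i = 0 \/ i = 1.
  by case: i => [[|[|//]] h]; [left|right]; apply: val_inj.
have cpt : coprime_forms q (p 0) (p 1).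
  rewrite /coprime_forms !sp /=; apply/andP; split.
    apply/negPn/negP => /closed_rootP[mu]; rewrite root_gcd => /andP[r0 r1].
    by apply: (no_root mu) => i; case: (I2 i) => ->.
  apply/negPn/negP; rewrite negb_or => /andP[s0 s1].
  apply: no_infty => i; rewrite -ltnS ltn_neqAle sp andbT.
  by case: (I2 i) => ->.
have Yp i : A *m J *m (poly_rV (p i))^T = 0.
  by rewrite rVpolyK tr_row colE mulmxA YK mul0mx.
apply/polar_mx_unitP => Phi; exact: (polar_pair_inj cpt two0 fY (Yp 0) (Yp 1)).
Qed.


End GeneralPosition.





(** Invertibility of this block is an affine chart of the Grassmannian. When the two outer columns
    vanish, the annihilating pair is [1] and ['X^(q.+2)], which is coprime; so the chart meets the
    locus where [polar_mx] is invertible. *)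
Definition middle (R : Type) (Y : 'M[R]_(q.+1, q.+3)) : 'M[R]_q.+1 :=
  colsub (fun b : 'I_q.+1 => lift ord0 (widen_ord (leqnSn _) b)) Y.

Definition in_chart (A : 'M[k]_(q.+1, N)) :=
  (middle (A *m J) \in unitmx) && (polar_mx (A *m J) \in unitmx).

Lemma middle_mul (R : comNzRingType) (P : 'M[R]_q.+1) Y : middle (P *m Y) = P *m middle Y.
Proof. by apply/matrixP => i j; rewrite !mxE; apply: eq_bigr => l _; rewrite mxE. Qed.

Lemma in_chart_scale c A : c != 0 -> in_chart A -> in_chart (c *: A).
Proof.
move=> c0 /andP[u1 u2]; have uc : (c%:M : 'M[k]_q.+1) \in unitmx.
  by rewrite unitmxE det_scalar unitfE expf_neq0.
rewrite /in_chart -scalemxAl -mul_scalar_mx middle_mul unitmx_mul uc u1.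
exact: polar_mx_unitM.
Qed.

Local Notation graph := (isotropic_graph C L D).

Lemma graph_row_free Y : row_free Y -> polar_mx Y \in unitmx -> row_free (graph Y).
Proof.
rewrite unitmxE unitfE => fY uY; rewrite -row_leq_rank.
apply: leq_trans (mxrankM_maxl _ J); rewrite graphJ //.
by rewrite (eqP (_ : row_free _)) // /row_free mxrank_scale_nz.
Qed.

Lemma graph_in_chart Y : middle Y \in unitmx -> polar_mx Y \in unitmx ->
  in_chart (graph Y).
Proof.
move=> mY uY; rewrite /in_chart graphJ // -mul_scalar_mx middle_mul unitmx_mul mY.
have uc : ((\det (polar_mx Y))%:M : 'M[k]_q.+1) \in unitmx.
  by rewrite unitmxE det_scalar unitfE expf_neq0 // -unitfE -unitmxE.
by rewrite uc polar_mx_unitM.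
Qed.

Lemma middle_row_free (Y : 'M[k]_(q.+1, q.+3)) : middle Y \in unitmx -> row_free Y.
Proof.
move=> uM; rewrite -kermx_eq0; apply/rowV0P => v /sub_kermxP vY.
have : v *m middle Y = 0.
  by apply/rowP => j; have /rowP/(_ (lift ord0 (widen_ord (leqnSn _) j))) := vY; rewrite !mxE => E; rewrite -[RHS]E; apply: eq_bigr => l _; rewrite mxE.
by move=> vM; rewrite -[v](mulmxK uM) vM mul0mx.
Qed.

Lemma chart_dense (Z : pset k #|incr_maps q.+1 N|) : zariski_closed Z ->
  (forall A, row_free A -> isotropic A -> in_chart A -> Z (pluecker A)) ->
  forall A : 'M[k]_(q.+1, N), row_free A -> isotropic A -> Z (pluecker A).
Proof.
move=> clZ hZ A; have [b] := ubnP (\sum_o \rank (A :&: signed_L o)%MS)%N.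
elim: b A => // b IH A; rewrite ltnS => bA fA iA.
case: (pickP (fun o => (A :&: signed_L o)%MS != 0)) => [o AL | AL0].
  have hN' : N = (q.+1.*2 + 3)%N by lia.
  have [B [d [d0 B0 Bt]]] := conic_move two0 lambda_inj hN' fA iA (isotropic_signed_L o) AL.
  have f0 : row_free (map_mx (horner_eval 0) B) by rewrite B0.
  (* Away from the zeros of the [e o'] no other intersection grows, so the sum of dimensions
     strictly drops. *)
  have [e he] := fin_all_exists (fun o' => rank_cap_semicontinuous (signed_L o') f0).
  have Emin t : map_mx (horner_eval t) (minors B) = pluecker (map_mx (horner_eval t) B).
    exact: map_minors.
  rewrite -B0 -Emin; apply: (@closed_curve _ _ _ _ (d * \prod_o' e o')) => //.
  - rewrite mulf_neq0 //; apply/prodf_neq0 => o' _.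
    by apply: contraTneq isT => eo; have [+ _] := he o'; rewrite eo horner0 eqxx.
  - move=> t; rewrite hornerM mulf_eq0 negb_or horner_prod => /andP[dt /prodf_neq0 et].
    have [fB iB lt] := Bt t dt; rewrite Emin; apply: IH => //.
    apply: leq_trans bA; rewrite (bigD1 o) //= [X in (_ < X)%N](bigD1 o) //=.
    rewrite -addSn leq_add //; apply: leq_sum => o' _; rewrite -B0.
    by have [_] := he o'; apply => //; apply: et.
  by rewrite Emin B0 pluecker_neq0.
have AL o : (A :&: signed_L o)%MS = 0 by apply/eqP; have := AL0 o; case: eqP.
have uY := general_position_unit fA iA AL; set Y := A *m J in uY.
have d0 : \det (polar_mx Y) != 0 by rewrite -unitfE -unitmxE.
(* In general position only the middle block may be singular. [E] has identity middle block, so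
   [Y + t E] enters the chart unless [- t] is an eigenvalue of [middle Y]. *)
pose E : 'M[k]_(q.+1, q.+3) := \matrix_(a, c) (c == a.+1 :> nat)%:R.
pose c := fun m n (M : 'M[k]_(m, n)) => map_mx (@polyC k) M.
pose Yt := c _ _ Y + 'X *: c _ _ E.
(* The constant factor makes the curve of isotropic subspaces pass through [A] itself at [t = 0], by
   [graph_unique]. *)
pose B := (\det (polar_mx Y))^-1%:P *: isotropic_graph (c _ _ C) (c _ _ L) (c _ _ D) Yt.
pose ev := fun m n t (M : 'M[{poly k}]_(m, n)) => map_mx (horner_eval t) M.
have EYt t : ev _ _ t Yt = Y + t *: E.
  by rewrite /ev /Yt map_mxD map_mxZ /= !map_horner_polyC /horner_eval hornerX.
have EB t : ev _ _ t B = (\det (polar_mx Y))^-1 *: graph (Y + t *: E).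
  rewrite /ev /B map_mxZ /= map_isotropic_graph /= !map_horner_polyC -/(ev _ _ t Yt) EYt.
  by rewrite /horner_eval hornerC.
have mid t : middle (Y + t *: E) = middle Y + t%:M.
  apply/matrixP => a b'; rewrite !mxE /= /bump /= add1n eqSS eq_sym.
  by rewrite mulr_natr.
have Emin t : map_mx (horner_eval t) (minors B) = pluecker (ev _ _ t B) by apply: map_minors.
have B0 : ev _ _ 0 B = A.
  rewrite EB scale0r addr0 (graph_unique hN lambda_inj kap0 residues CJ iA).
  by rewrite scalerA mulVf // scale1r.
rewrite -B0 -Emin; apply: (@closed_curve _ _ _ _ (char_poly (- middle Y) * \det (polar_mx Yt))) => //.
- rewrite mulf_neq0 //; first by rewrite monic_neq0 ?char_poly_monic.
  apply: contraNneq d0 => /(congr1 (horner_eval 0)).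
  by rewrite -det_map_mx map_polar_mx -/(ev _ _ 0 Yt) EYt scale0r addr0 /horner_eval horner0 => ->.
- move=> t; rewrite hornerM mulf_eq0 negb_or => /andP[].
  have -> : (char_poly (- middle Y)).[t] = \det (middle (Y + t *: E)).
    rewrite -[LHS]/(horner_eval t _) -det_map_mx mid; congr (\det _).
    move: (middle Y) => M; apply/matrixP => a b'; rewrite !mxE /= /horner_eval.
    by rewrite hornerD hornerN hornerC hornerMn hornerX opprK addrC.
  rewrite -[(\det (polar_mx Yt)).[t]]/(horner_eval t _) -det_map_mx map_polar_mx.
  rewrite -/(ev _ _ t Yt) EYt -!unitfE -!unitmxE => uM uP.
  rewrite Emin EB; have di : (\det (polar_mx Y))^-1 != 0 by rewrite invr_eq0.
  have fr : row_free (graph (Y + t *: E)) by rewrite graph_row_free // middle_row_free.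
  apply: hZ; last by rewrite in_chart_scale // graph_in_chart.
    by rewrite /row_free mxrank_scale_nz.
  have : isotropic (graph (Y + t *: E)).
    by apply: (graph_isotropic hN residues CJ); rewrite -unitfE -unitmxE.
  case=> g0 g1; split; rewrite linearZ /= -!scalemxAl -scalemxAr ?g0 ?g1 ?scaler0 //.
by rewrite Emin B0 pluecker_neq0.
Qed.

End Density.

(** * The birational map *)

Section Coordinates.

Variables (R : comNzRingType) (q : nat).

(* Row [a] of [chart_mx v] is the [a]-th basis vector preceded and followed by
   one free entry; the factor [v 0 0] makes the entries linear forms in [v]. *)
Definition chart_mx (v : 'rV[R]_(q.+1 + q.+1).+1) : 'M[R]_(q.+1, q.+3) :=
  \matrix_(a, c) if c == 0 then v 0 (lift ord0 (lshift q.+1 a))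
    else if c == ord_max then v 0 (lift ord0 (rshift q.+1 a))
    else (v 0 0) *+ (c == a.+1 :> nat).

Definition coords (v0 : R) (Y : 'M[R]_(q.+1, q.+3)) : 'rV[R]_(q.+1 + q.+1).+1 :=
  \row_j if unlift ord0 j is Some j' then
    match split j' with inl a => Y a 0 | inr a => Y a ord_max end else v0.

Lemma middle_chart_mx v : middle (chart_mx v) = (v 0 0)%:M.
Proof.
apply/matrixP => a b; rewrite !mxE; case: eqP => [/(congr1 val)//|_].
case: eqP => [/(congr1 val) /= E|_].
  by have := ltn_ord b; move: E; rewrite /bump /= !add1n; lia.
by rewrite /= /bump add1n eqSS eq_sym.
Qed.

Lemma chart_mx_coords v0 Y : middle Y = v0%:M -> chart_mx (coords v0 Y) = Y.
Proof.
move=> /matrixP mY; apply/matrixP => a c; rewrite !mxE !liftK unlift_none.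
rewrite (unsplitK (inl a)) (unsplitK (inr a)).
case: eqP => [-> //|c0]; case: eqP => [-> //|cm].
have cb : (c.-1 < q.+1)%N.
  have c0' : (c : nat) != 0%N by apply/eqP => E; apply: c0; apply: val_inj.
  have cm' : (c : nat) != q.+2 by apply/eqP => E; apply: cm; apply: val_inj.
  by have := ltn_ord c; lia.
have Ec : c = lift ord0 (widen_ord (leqnSn q.+1) (Ordinal cb)).
  have c0' : (c : nat) != 0%N by apply/eqP => E; apply: c0; apply: val_inj.
  by apply: val_inj; rewrite /= /bump /= add1n prednK // lt0n.
have := mY a (Ordinal cb); rewrite !mxE -Ec => ->; congr (_ *+ _).
by rewrite {1}Ec /= /bump add1n eqSS eq_sym.
Qed.

Lemma coords_chart_mx (v : 'rV[R]_(q.+1 + q.+1).+1) : coords (v 0 0) (chart_mx v) = v.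
Proof.
apply/rowP => j; rewrite !mxE; case: unliftP => [j' ->|-> //].
by case: splitP => a Ea; rewrite mxE ?eqxx /=; congr (v _ (lift _ _)); apply: val_inj.
Qed.

Lemma coordsZ c v0 Y : coords (c * v0) (c *: Y) = c *: coords v0 Y.
Proof.
apply/rowP => j; rewrite !mxE; case: (unlift _ _) => [j'|//].
by case: (split j') => a; rewrite mxE.
Qed.


End Coordinates.

Lemma map_chart_mx (R S : comNzRingType) (f : {rmorphism R -> S}) q
    (v : 'rV[R]_(q.+1 + q.+1).+1) : map_mx f (chart_mx v) = chart_mx (map_mx f v).
Proof.
apply/matrixP => a c; rewrite !mxE; case: ifP => // _; case: ifP => // _.
by rewrite rmorphMn.
Qed.

Lemma map_coords (R S : comNzRingType) (f : {rmorphism R -> S}) q v0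
    (Y : 'M[R]_(q.+1, q.+3)) : map_mx f (coords v0 Y) = coords (f v0) (map_mx f Y).
Proof.
apply/rowP => j; rewrite !mxE; case: (unlift _ _) => [j'|//].
by case: (split j') => a; rewrite mxE.
Qed.

Section LinearForms.

Variables (k : closedFieldType) (q N : nat).

Lemma pluecker_form (K : 'M[k]_(N, q.+1)) :
  exists p : {mpoly k[#|incr_maps q.+1 N|]}, p \is 1.-homog /\
    forall A : 'M[k]_(q.+1, N), p.@[pluecker A 0] = \det (A *m K).
Proof.
have [c Ec] := det_mulmx_minors K; exists (\sum_s c s *: 'X_s); split=> [|A].
  by rewrite rpred_sum // => s _; apply: dhomogZ; rewrite dhomogX /= mdeg1.
rewrite raddf_sum Ec; apply: eq_bigr => s _ /=.
by rewrite mevalZ mevalXU.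
Qed.

(** By Cramer's rule the entry [(a, c)] is the determinant of the middle block with column [a]
    replaced by column [c] of [A *m J], hence a linear form in the Pluecker coordinates. *)
Lemma adj_middle_forms (J : 'M[k]_(N, q.+3)) :
  exists PY : 'M[{mpoly k[#|incr_maps q.+1 N|]}]_(q.+1, q.+3), homog_mx 1 PY /\
    forall A : 'M[k]_(q.+1, N), map_mx (meval (pluecker A 0)) PY =
      \adj (middle (A *m J)) *m (A *m J).
Proof.
pose mid (b : 'I_q.+1) := lift ord0 (widen_ord (leqnSn q.+1) b).
pose K (a : 'I_q.+1) (c : 'I_q.+3) : 'M[k]_(N, q.+1) :=
  \matrix_(l, j) if j == a then J l c else J l (mid j).
have [P hP] := fin_all_exists (fun x => pluecker_form (K x.1 x.2)).
exists (\matrix_(a, c) P (a, c)); split=> [a c|A].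
  by rewrite mxE; have [] := hP (a, c).
apply/matrixP => a c; rewrite [LHS]mxE [X in meval _ X]mxE.
have [_ ->] := hP (a, c); rewrite (expand_det_col _ a) [RHS]mxE; apply: eq_bigr => i _.
rewrite [RHS]mulrC; congr (_ * _).
  by rewrite !mxE; apply: eq_bigr => l _; rewrite mxE eqxx.
rewrite [RHS]mxE /cofactor; congr (_ * \det _); apply/matrixP => s t; rewrite !mxE.
by apply: eq_bigr => l _; rewrite mxE eq_sym (negPf (neq_lift _ _)).
Qed.

End LinearForms.

Section Birational.

Variables (k : closedFieldType) (q N : nat) (lambda kap : 'I_N -> k).
Hypothesis hN : N = (q.*2 + 5)%N.
Hypothesis two0 : (2%:R : k) != 0.
Hypothesis lambda_inj : injective lambda.
Hypothesis kap0 : forall i, kap i != 0.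
Hypothesis residues :
  forall p : {poly k}, (size p < N)%N -> \sum_i kap i ^+ 2 * p.[lambda i] = 0.

Local Notation D := (lambda_mx lambda).
Local Notation J := (poly_pairing q lambda kap).
Local Notation L := (low_degree q lambda kap).
Local Notation isotropic := (isotropic lambda).
Local Notation in_chart := (in_chart lambda kap).
Local Notation K := #|incr_maps q.+1 N|.
Local Notation n := (q.+1 + q.+1)%N.

Variable C : 'M[k]_(q.+3, N).
Hypothesis CJ : C *m J = 1%:M.

Local Notation graph := (isotropic_graph C L D).

Variable G : pset k K.
Hypothesis GP : forall w, G w <->
  exists A : 'M[k]_(q.+1, N), [/\ row_free A, isotropic A & w = pluecker A].

Variables (p0 : {mpoly k[K]}) (PY : 'M[{mpoly k[K]}]_(q.+1, q.+3)).
Hypotheses (hp0 : p0 \is 1.-homog) (hPY : homog_mx 1 PY).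
Hypothesis p0E : forall A : 'M[k]_(q.+1, N), p0.@[pluecker A 0] = \det (middle (A *m J)).
Hypothesis PYE : forall A : 'M[k]_(q.+1, N),
  map_mx (meval (pluecker A 0)) PY = \adj (middle (A *m J)) *m (A *m J).

Lemma closed_hypersurface m (p : {mpoly k[m]}) d : p \is d.-homog ->
  zariski_closed (fun x => x != 0 /\ p.@[x 0] = 0).
Proof.
move=> hp; exists (fun p' => p' = p); split=> [_ ->|x]; first by exists d.
by split=> -[x0 hx]; split=> //; [move=> p' -> | exact: hx].
Qed.

Lemma open_in_self m (X : pset k m) : open_in X X.
Proof.
exists (fun=> False); split; last by move=> x; split=> [Xx|[]//]; split.
exists (fun p => p = 1); split=> [_ ->|x]; first by exists 0%N; rewrite dhomog1.
split=> // -[_ /(_ 1 erefl)]; rewrite meval1 => /eqP; by rewrite oner_eq0.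
Qed.

Lemma regular_forms m m' (X : pset k m) (Y : pset k m') d (P : 'rV[{mpoly k[m]}]_m') :
  homog_mx d P -> (forall x, X x -> Y (map_mx (meval (x 0)) P)) -> (forall y, Y y -> y != 0) ->
  regular_map X Y (fun x => map_mx (meval (x 0)) P).
Proof.
move=> hP XY Y0; split=> // x Xx; exists X, d, (P 0); split=> //.
  exact: open_in_self.
move=> y Xy; have -> : \row_j (P 0 j).@[y 0] = map_mx (meval (y 0)) P.
  by apply/rowP => j; rewrite !mxE.
by rewrite Y0 ?submx_refl //; apply: XY.
Qed.

Let X : 'rV[{mpoly k[n.+1]}]_n.+1 := \row_j 'X_j.

Let evX (v : 'rV[k]_n.+1) : map_mx (meval (v 0)) X = v.
Proof. by apply/rowP => j; rewrite !mxE mevalXU. Qed.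

Let homX : homog_mx 1 (chart_mx X).
Proof.
have hX j : X 0 j \is 1.-homog by rewrite mxE dhomogX /= mdeg1.
move=> a c; rewrite mxE; case: ifP => // _; case: ifP => // _.
by apply: rpredMn.
Qed.

Let ZV : pset k n.+1 := fun v => v != 0 /\ ('X_0 * \det (polar_mx (chart_mx X))).@[v 0] = 0.
(** At [pluecker A] the matrix [PY] has the row space of [A *m J] once the middle block is
    invertible, so removing [ZU] leaves the subspaces satisfying [in_chart]. *)
Let ZU : pset k K := fun w => w != 0 /\ (p0 * \det (polar_mx PY)).@[w 0] = 0.
Let U : pset k K := fun w => G w /\ ~ ZU w.
Let V : pset k n.+1 := fun v => proj_space v /\ ~ ZV v.

Let VP v : V v <-> v 0 0 != 0 /\ polar_mx (chart_mx v) \in unitmx.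
Proof.
have Ev : ('X_0 * \det (polar_mx (chart_mx X))).@[v 0] =
    v 0 0 * \det (polar_mx (chart_mx v)).
  by rewrite mevalM mevalXU -det_map_mx map_polar_mx map_chart_mx evX.
rewrite unitmxE unitfE /V /ZV Ev; split=> [[v0 nZ] | [v00 d0]].
  apply/andP; rewrite -negb_or -mulf_eq0; apply/eqP => E; by apply: nZ.
split; first by apply: contraNneq v00 => ->; rewrite mxE.
by case=> _ /eqP; rewrite mulf_eq0 (negPf v00) (negPf d0).
Qed.

Let adj_unit (M : 'M[k]_q.+1) : M \in unitmx -> \adj M \in unitmx.
Proof.
rewrite !unitmxE !unitfE => dM; apply: contraNneq dM => aM.
have := congr1 determinant (mul_mx_adj M); rewrite det_mulmx aM mulr0 det_scalar.
by move/esym/eqP; rewrite expf_eq0.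
Qed.

Let UP w : U w <-> exists A : 'M[k]_(q.+1, N),
  [/\ row_free A, isotropic A, in_chart A & w = pluecker A].
Proof.
have ED A : (p0 * \det (polar_mx PY)).@[pluecker A 0] = 
    \det (middle (A *m J)) * \det (polar_mx (\adj (middle (A *m J)) *m (A *m J))).
  by rewrite mevalM p0E -det_map_mx map_polar_mx PYE.
split=> [[/GP[A [fA iA Ew]] nZ]|[A [fA iA /andP[uM uP] ->]]].
  exists A; split=> //; have : \det (middle (A *m J)) *
      \det (polar_mx (\adj (middle (A *m J)) *m (A *m J))) != 0.
    apply/eqP => E; apply: nZ; split; first by rewrite Ew pluecker_neq0.
    by rewrite Ew ED.
  rewrite mulf_eq0 negb_or -!unitfE -!unitmxE => /andP[uM uP]; apply/andP; split=> //.
  have ui : invmx (\adj (middle (A *m J))) \in unitmx by rewrite unitmx_inv adj_unit.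
  by have := polar_mx_unitM ui uP; rewrite mulKmx ?adj_unit.
split; first by apply/GP; exists A.
case=> _ /eqP; rewrite ED mulf_eq0 => /orP[|].
  by apply/negP; rewrite -unitfE -unitmxE.
by apply/negP; rewrite -unitfE -unitmxE polar_mx_unitM ?adj_unit.
Qed.

Let F : 'rV[{mpoly k[K]}]_n.+1 := coords p0 PY.
Let H : 'rV[{mpoly k[n.+1]}]_K := minors (isotropic_graph (map_mx (@mpolyC n.+1 k) C)
  (map_mx (@mpolyC n.+1 k) L) (map_mx (@mpolyC n.+1 k) D) (chart_mx X)).
Let f (w : 'rV[k]_K) := map_mx (meval (w 0)) F.
Let h (v : 'rV[k]_n.+1) := map_mx (meval (v 0)) H.

Let fE A : f (pluecker A) =
  coords (\det (middle (A *m J))) (\adj (middle (A *m J)) *m (A *m J)).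
Proof. by rewrite /f /F map_coords PYE /= p0E. Qed.

Let map_mpolyC m (v : 'I_m -> k) r s (M : 'M[k]_(r, s)) :
  map_mx (meval v) (map_mx (@mpolyC m k) M) = M.
Proof. by apply/matrixP => i j; rewrite !mxE mevalC. Qed.

Let hE v : h v = pluecker (graph (chart_mx v)).
Proof.
rewrite /h /H map_minors; congr minors.
by rewrite map_isotropic_graph !map_mpolyC map_chart_mx evX.
Qed.

Let chart_f A : chart_mx (f (pluecker A)) = \adj (middle (A *m J)) *m (A *m J).
Proof. by rewrite fE chart_mx_coords // middle_mul mul_adj_mx. Qed.

Let fV w : U w -> V (f w).
Proof.
case/UP => A [fA iA /andP[uM uP] ->]; apply/VP; rewrite chart_f; split.
  by rewrite fE mxE unlift_none -unitfE -unitmxE.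
by rewrite polar_mx_unitM ?adj_unit.
Qed.

Let hU v : V v -> U (h v).
Proof.
case/VP => v00 uP; apply/UP; exists (graph (chart_mx v)).
have uM : middle (chart_mx v) \in unitmx.
  by rewrite middle_chart_mx unitmxE det_scalar unitfE expf_neq0.
split; last exact: hE.
- exact: (graph_row_free hN residues CJ (middle_row_free uM)).
- by apply: (graph_isotropic hN residues CJ); rewrite -unitfE -unitmxE.
exact: (graph_in_chart hN residues CJ).
Qed.

Let scale_eqmx m (c : k) (u : 'rV[k]_m) : c != 0 -> (c *: u == u)%MS.
Proof. by move=> c0; apply/eqmxP/eqmx_scale. Qed.

(** The image under [f] encodes [Q *m A *m J] with [Q] invertible; [graph_unique] returns a multiple
    of [Q *m A], whose minors are proportional to those of [A]. *)
Let hf w : U w -> (h (f w) == w)%MS.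
Proof.
case/UP => A [fA iA /andP[uM uP] ->]; rewrite hE chart_f mulmxA.
set Q := \adj _; have uQ : Q \in unitmx by apply: adj_unit.
have iQA : isotropic (Q *m A).
  by case: iA => A0 A1; split; rewrite trmx_mul -!mulmxA ?(mulmxA A) ?(mulmxA (A *m D)) ?A0 ?A1 mul0mx mulmx0.
rewrite (graph_unique hN lambda_inj kap0 residues CJ iQA) -mul_scalar_mx mulmxA.
rewrite [pluecker _]minors_mulmx; apply: scale_eqmx.
rewrite -unitfE -unitmxE unitmx_mul uQ andbT unitmxE det_scalar unitfE expf_neq0 //.
by rewrite -unitfE -unitmxE -mulmxA polar_mx_unitM.
Qed.

Let fh v : V v -> (f (h v) == v)%MS.
Proof.
case/VP => v00; rewrite unitmxE unitfE; set d := \det _ => d0.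
pose A := graph (chart_mx v).
have AJ : A *m J = d *: chart_mx v by apply: (graphJ hN residues CJ).
have mA : middle (A *m J) = (d * v 0 0)%:M.
  by rewrite AJ -mul_scalar_mx middle_mul middle_chart_mx -scalar_mxM.
rewrite hE -/A fE mA; set M := (d * v 0 0)%:M.
have dv : d * v 0 0 != 0 by rewrite mulf_neq0.
have aM : \adj M = (\det M / (d * v 0 0))%:M.
  have := mul_adj_mx M; rewrite {2}/M mul_mx_scalar => /(congr1 (GRing.scale (d * v 0 0)^-1)).
  by rewrite scalerA mulVf // scale1r scale_scalar_mx mulrC.
have dM : \det M != 0 by rewrite det_scalar expf_neq0.
rewrite aM AJ mul_scalar_mx scalerA.
have -> : \det M / (d * v 0 0) * d = \det M / v 0 0 by field; rewrite v00 d0.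
have -> : coords (\det M) ((\det M / v 0 0) *: chart_mx v) = (\det M / v 0 0) *: v.
  by rewrite -[X in _ = _ *: X](coords_chart_mx v) -coordsZ divfK.
by apply: scale_eqmx; rewrite mulf_neq0 ?invr_eq0.
Qed.

Lemma birational_chart : birational G (@proj_space k n).
Proof.
exists U, V; split.
- exists ZU; split=> //; apply: closed_hypersurface.
  by apply: dhomogM hp0 _; apply: homog_det (homog_polar_mx hPY).
- move=> Z clZ UZ w /GP[A [fA iA ->]].
  apply: (chart_dense hN two0 lambda_inj kap0 residues CJ clZ) => // B fB iB cB.
  by apply: UZ; apply/UP; exists B.
- exists ZV; split=> //; apply: closed_hypersurface.
  by apply: dhomogM; [rewrite dhomogX /= mdeg1 | apply: homog_det (homog_polar_mx homX)].
- move=> Z clZ VZ v v0.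
  (* Join [v] by a line to [e], whose chart matrix has zero outer columns and is annihilated by the
     coprime pair [1] and ['X^(q.+2)]; so [d] is nonzero at [t = 1]. *)
  pose e : 'rV[k]_n.+1 := delta_mx 0 0.
  pose c := fun m m' (M : 'M[k]_(m, m')) => map_mx (@polyC k) M.
  pose vt := c _ _ v + 'X *: c _ _ (e - v).
  have Ev t : map_mx (horner_eval t) vt = v + t *: (e - v).
    by rewrite /vt map_mxD map_mxZ /= !map_horner_polyC /horner_eval hornerX.
  have Ev0 : map_mx (horner_eval 0) vt = v by rewrite Ev scale0r addr0.
  pose d := vt 0 0 * \det (polar_mx (chart_mx vt)).
  have Ed t : d.[t] = (map_mx (horner_eval t) vt) 0 0 *
      \det (polar_mx (chart_mx (map_mx (horner_eval t) vt))).
    rewrite hornerM -map_chart_mx -map_polar_mx det_map_mx.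
    by rewrite [X in _ = X * _]mxE.
  rewrite -Ev0; apply: (@closed_curve _ _ _ _ d) => //; last by rewrite Ev0.
    apply: contraTneq isT => /(congr1 (horner^~ 1)); rewrite horner0 Ed Ev scale1r addrC subrK.
    have e00 : e 0 0 = 1 by rewrite mxE !eqxx.
    rewrite e00 mul1r => /eqP; rewrite -[_ == 0]negbK -unitfE -unitmxE => /negP; case.
    have ce : coprime_forms q (1 : {poly k}) 'X^(q.+2).
      by rewrite /coprime_forms size_poly1 size_polyXn eqxx orbT coprime1p /= ltnSn.
    apply/polar_mx_unitP => Phi; apply: (polar_pair_inj ce two0).
    - by apply: middle_row_free; rewrite middle_chart_mx e00 unitmx1.
    - apply/colP => a; rewrite !mxE big1 // => j _; rewrite !mxE coef1.
      case: ifP => [_|j0]; first by rewrite mul0r.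
      by have -> : (j == 0 :> nat) = false by []; rewrite mulr0.
    apply/colP => a; rewrite !mxE big1 // => j _; rewrite !mxE coefXn.
    case: ifP => [_|_]; first by rewrite mul0r.
    case: eqP => [->|jm]; first by rewrite mul0r.
    have -> : (j == q.+2 :> nat) = false by apply/eqP => E; apply: jm; apply: val_inj.
    by rewrite mulr0.
  move=> t; rewrite Ed mulf_eq0 negb_or => /andP[v00 dt]; apply: VZ; apply/VP.
  by rewrite unitmxE unitfE.
exists f, h; split=> //.
- apply: (@regular_forms _ _ _ _ 1%N) => //.
    move=> i j; rewrite mxE; case: (unlift _ _) => [j'|//].
    by case: (split j').
  by move=> v [].
- apply: regular_forms (homog_minors (homog_isotropic_graph _ _ _ homX)) _ _ => //.
  by move=> w /UP[A [fA _ _ ->]]; apply: pluecker_neq0.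
Qed.

End Birational.

(** * From points of the quadrics to isotropic matrices, and the theorem *)

Section Quadrics.

Variables (k : closedFieldType) (n : nat) (lambda : 'I_n.+1 -> k).
Hypothesis two0 : (2%:R : k) != 0.

Lemma diag_form (a : 'I_n.+1 -> k) (x : 'rV[k]_n.+1) :
  bform (diag_mx (\row_j a j)) x x = \sum_j a j * x 0 j ^+ 2.
Proof.
rewrite /bform mxE; apply: eq_bigr => j _.
by rewrite mul_mx_diag !mxE expr2 mulrAC mulrC.
Qed.

Lemma polarization m (A : 'M[k]_(m, n.+1)) (a : 'I_n.+1 -> k) :
  (forall x : 'rV_n.+1, x != 0 -> (x <= A)%MS -> \sum_j a j * x 0 j ^+ 2 = 0) ->
  A *m diag_mx (\row_j a j) *m A^T = 0.
Proof.
move=> hA; set M := diag_mx _; have sM : M^T = M by rewrite tr_diag_mx.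
have q0 (x : 'rV_n.+1) : (x <= A)%MS -> bform M x x = 0.
  move=> xA; have [->|x0] := eqVneq x 0; first by rewrite /bform !mul0mx mxE.
  by rewrite diag_form hA.
apply: bform_mx0 => u v; apply: (antisymmetric_eq0 two0).
have := q0 (u *m A + v *m A); rewrite -mulmxDl submxMl mulmxDl => /(_ isT).
rewrite !(bformDl, bformDr) !q0 ?submxMl // add0r addr0.
by rewrite (bformC (v *m A)).
Qed.

Lemma isotropicP m (A : 'M[k]_(m, n.+1)) : isotropic lambda A <->
  forall x : 'rV_n.+1, x != 0 -> (x <= A)%MS ->
    diag_quadric (fun=> 1) x /\ diag_quadric lambda x.
Proof.
have E1 : diag_mx (\row_(j < n.+1) (1 : k)) = 1%:M.
  by apply/matrixP => i j; rewrite !mxE.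
split=> [[A0 A1] x x0 xA | h].
  split; split=> //; rewrite -diag_form; last exact: (bform_sub A1 xA xA).
  by apply: (bform_sub _ xA xA); rewrite E1 mulmx1.
split; last by apply: polarization => x x0 /(h x x0)[_ []].
by rewrite -[A in A *m _]mulmx1 -E1; apply: polarization => x x0 /(h x x0)[[]].
Qed.

Lemma linear_subspacesP q (w : 'rV[k]_#|incr_maps q.+1 n.+1|) :
  linear_subspaces_in q
    (fun x => diag_quadric (fun _ : 'I_n.+1 => 1 : k) x /\ diag_quadric lambda x) w <->
  exists A : 'M[k]_(q.+1, n.+1), [/\ row_free A, isotropic lambda A & w = pluecker A].
Proof.
split=> [[A [fA XA wA]] | [A [fA /isotropicP iA ->]]]; last first.
  by exists A; split=> //; rewrite submx_refl.
have [A' [EA ->]] := eq_pluecker_row_space fA wA.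
exists A'; split=> //; first by rewrite /row_free EA.
by apply/isotropicP => x x0; rewrite EA; apply: XA.
Qed.

End Quadrics.

Unset Implicit Arguments.

Theorem mainTheorem2 (k : closedFieldType) (char0 : [pchar k] =i pred0)
    (g : nat) (hg : (2 <= g)%N)
    (lambda : 'I_(2 * g).+1 -> k) (hlambda : injective lambda) :
  let Q1 := diag_quadric (fun _ : 'I_(2 * g).+1 => 1 : k) in
  let Q2 := diag_quadric lambda in
  rational (linear_subspaces_in (g - 2) (fun x => Q1 x /\ Q2 x)).
Proof.
move=> Q1 Q2; have two0 : (2%:R : k) != 0.
  by have := char0 2; rewrite !inE /= => ->.
have [q Eq] : exists q, q = (g - 2)%N by exists (g - 2)%N.
rewrite -Eq; have hN : (2 * g).+1 = (q.*2 + 5)%N by lia.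
have [kap [kap0 res]] := exists_weights hlambda.
have /row_fullP[C CJ] := J_full hN hlambda kap0.
have [p0 [hp0 p0E]] := pluecker_form
  (colsub (fun b : 'I_q.+1 => lift ord0 (widen_ord (leqnSn _) b)) (poly_pairing q lambda kap)).
have [PY [hPY PYE]] := adj_middle_forms (poly_pairing q lambda kap).
(* This is [2g - 2], the dimension of the Grassmannian of [(g - 1)]-dimensional subspaces in
   dimension [g + 1]. *)
exists (q.+1 + q.+1)%N.
apply: (birational_chart hN two0 hlambda kap0 res CJ _ hp0 hPY _ PYE).
  exact: (linear_subspacesP lambda two0).
move=> A; rewrite p0E; congr (\det _).
by apply/matrixP => i j; rewrite !mxE; apply: eq_bigr => l _; rewrite mxE.
Qed.
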